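(* For $|q|<1$, \begin{align*} \sum_{i,j,k\geq 0}\frac{q^{4i^2+2j^2+k^2+4ij-2ik-2jk}}{(q^2;q^2)_i(q^2;q^2)_j(q^2;q^2)_k}&=\frac{J_2^3J_{5,12}}{J_1^2J_4^2}, \\ \sum_{i,j,k\geq 0} \frac{q^{2i^2+j^2+\frac{1}{2}k^2+2ij-ik-jk+\frac{1}{2}k}}{(q;q)_i(q;q)_j(q;q)_k}&=\frac{J_2^2J_3^2}{J_1^3J_{6}}, \\ \sum_{i,j,k\geq 0} \frac{q^{4i^2+2j^2+k^2+4ij-2ik-2jk+2i}}{(q^2;q^2)_i(q^2;q^2)_j(q^2;q^2)_k}&=\frac{J_2^3J_{3,12}}{J_1^2J_4^2},\\ \sum_{i,j,k\geq 0} \frac{q^{2i^2+j^2+\frac{1}{2}k^2+2ij-ik-jk+2i+j-\frac{1}{2}k}}{(q;q)_i(q;q)_j(q;q)_k}&=2\frac{J_2J_6^2}{J_1^2J_3}, \\ \sum_{i,j,k\geq 0} \frac{q^{4i^2+2j^2+k^2+4ij-2ik-2jk+4i+2j}}{(q^2;q^2)_i(q^2;q^2)_j(q^2;q^2)_k}&=\frac{J_2^3J_{1,12}}{J_1^2J_4^2}. \end{align*}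
   Context: For $|q|<1$: $(a;q)_n=\prod_{k=0}^{n-1}(1-aq^k)$ ($(a;q)_0=1$), $(a;q)_\infty=\prod_{k\ge0}(1-aq^k)$; $J_m:=(q^m;q^m)_\infty$ and $J_{a,m}:=(q^a;q^m)_\infty(q^{m-a};q^m)_\infty(q^m;q^m)_\infty$. Half-integer powers of $q$ use a fixed choice of $q^{1/2}$ (e.g. $0<q<1$). *)

(* Defs.v *)
From mathcomp Require Import all_boot all_order all_algebra.
From mathcomp Require Import all_classical all_reals all_analysis.
From mathcomp Require Import complex.
Import Order.TTheory GRing.Theory Num.Theory numFieldNormedType.Exports.
Local Open Scope ring_scope.
Local Open Scope classical_set_scope.

Definition Cx (R : realType) : numClosedFieldType := R[i].

Definition qpoch {R : realType} (a q : Cx R) (n : nat) : Cx R :=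
  \prod_(k < n) (1 - a * q ^+ k).

Definition qpoch_inf {R : realType} (a q : Cx R) : Cx R :=
  lim ((fun n => qpoch a q n) @ \oo).

Definition J {R : realType} (m : nat) (q : Cx R) : Cx R :=
  qpoch_inf (q ^+ m) (q ^+ m).

Definition Jam {R : realType} (a m : nat) (q : Cx R) : Cx R :=
  qpoch_inf (q ^+ a) (q ^+ m) * qpoch_inf (q ^+ (m - a)) (q ^+ m) * J m q.

Definition tsum {R : realType} (F : nat -> nat -> nat -> Cx R) (N : nat) : Cx R :=
  \sum_(i < N) \sum_(j < N) \sum_(k < N) F i j k.

Definition tseries_to {R : realType} (F : nat -> nat -> nat -> Cx R) (s : Cx R) : Prop :=
  (tsum F) @ \oo --> s.

(* Main.v *)
Require Import Defs.
From mathcomp Require Import all_boot all_order all_algebra.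
From mathcomp Require Import all_classical all_reals all_analysis.
From mathcomp Require Import complex zify ring.
Import Order.TTheory GRing.Theory Num.Theory numFieldNormedType.Exports.
Local Open Scope ring_scope.
Local Open Scope classical_set_scope.
Set Implicit Arguments.
Unset Strict Implicit.
Unset Printing Implicit Defensive.

(** Summing over k first with Euler's identity, and setting n = i + j, turns each
triple sum into (-b/y; b)_oo times a single sum over n of w_n beta_n, where
w_n = z^n b^(n choose 2) (-y; b)_n, y z = b^(1+e), and
beta_n = sum_m b^(m^2+fm) / ((b;b)_m (b;b)_(n-m)), with e, f in {0, 1}.  Two
applications of the finite Bailey lemma to the unit Bailey pair give beta_n as a
bilateral sum of c_r / ((b;b)_(n-r) (b;b)_(n+r+e)), and the limiting q-Gauss sum
evaluates sum_n w_n / ((b;b)_(n-r) (b;b)_(n+r+e)).  What is left is a theta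
series in r, which Jacobi's triple product evaluates.  All finite identities
(q-Vandermonde, Euler, q-Gauss) are instances of one polynomial identity,
[q_chu_vandermonde], and all limits are interchanged by Tannery's theorem with
geometric majorants.  At q = 0 both sides are computed directly. *)

(** * Finite identities and Bailey pairs *)

(** Up to linear terms and a factor 1/2, every exponent is 2i^2 + n^2 + (k-n)^2 with n = i + j.
    These squares give the geometric majorant for the rearrangement; it has to be taken from the
    triple sum, since the factor (-(b/y) b^-n; b)_oo produced by the sum over k grows with n. The
    ratio z/y is 1 or b, and it decides the last step: for z = y the limiting q-Gauss sum yields
    theta terms at once, while for z = y b a denominator 1 + y b^k is left over, removed either by
    joining r with its mirror image -1-r or by averaging two forms of the unit pair. The parameter e
    belongs to the weight w_n and f to beta_n; they differ only in the third identity, where a pair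
    relative to b must be reread relative to 1. Sums over r run over all integers, so the reflection
    r -> -r-e of the kernel and the bilateral theta series need no separate treatment of r = 0. The
    point q = 0 stands apart because negative powers of b occur throughout. *)

Lemma sum_drop (V : nmodType) (F : nat -> V) (k n : nat) : (k <= n)%N ->
  (forall m, (m < k)%N -> F m = 0) ->
  \sum_(m < n.+1) F m = \sum_(t < (n - k).+1) F (t + k)%N.
Proof.
move=> le_kn F0; rewrite -(big_mkord xpredT F) (@big_cat_nat _ _ _ k) //=; last by lia.
rewrite big_nat_cond big1 ?add0r; last by move=> m; rewrite andbT => /F0.
by rewrite -[in LHS](add0n k) big_addn big_mkord subSn // add0n.
Qed.

(* A bilateral sum: since [Negz r] is - (r + 1), r runs over -N, ..., N - 1. *)
Definition bisum (R : realType) (N : nat) (f : int -> Cx R) : Cx R :=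
  \sum_(r < N) (f (Posz r) + f (Negz r)).

(** Kernels of index n live on -(n+e) <= r <= n. Since any [N] beyond n gives the same sum, one [N]
    serves all smaller indices and finite sums can be exchanged; the shifted form is the one that
    [q_chu_vandermonde] can evaluate. *)
Lemma bisum_shift (R : realType) (N n e : nat) (f : int -> Cx R) : (e <= 1)%N -> (n < N)%N ->
  (forall r : nat, (n < r)%N -> f r = 0) ->
  (forall r : nat, (n + e <= r)%N -> f (Negz r) = 0) ->
  bisum N f = \sum_(s < (n + n + e).+1) f (s%:Z - (n + e)%N%:Z).
Proof.
move=> le1 lt_nN f1 f2.
have trunc (g : nat -> Cx R) a : (a <= N)%N -> (forall r, (a <= r)%N -> g r = 0) ->
    \sum_(r < N) g r = \sum_(r < a) g r.
  move=> le_aN g0; rewrite -(big_mkord xpredT g) (@big_cat_nat _ _ _ a) //= big_mkord.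
  rewrite [X in _ + X]big_nat_cond [X in _ + X]big1 ?addr0 // => i.
  by rewrite andbT => /andP[? _]; apply: g0.
rewrite /bisum big_split /= (trunc (fun r => f (Posz r)) n.+1) //.
rewrite (trunc (fun r => f (Negz r)) (n + e)%N) //; last by lia.
have -> : ((n + n + e).+1 = (n + e) + n.+1)%N by lia.
rewrite [RHS]big_split_ord /= addrC; congr (_ + _).
  rewrite (reindex_inj rev_ord_inj); apply: eq_bigr => -[r /= lt_r] _.
  by congr f; lia.
by apply: eq_bigr => -[r /= lt_r] _; congr f; lia.
Qed.

Section FiniteIdentities.
Variables (R : realType) (b : Cx R).
Hypothesis b1 : forall n, 1 - b ^+ n.+1 != 0.

Local Notation pb := (qpoch b b).

Lemma qpoch0 (a c : Cx R) : qpoch a c 0 = 1.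
Proof. by rewrite /qpoch big_ord0. Qed.

Lemma qpochS (a c : Cx R) n : qpoch a c n.+1 = qpoch a c n * (1 - a * c ^+ n).
Proof. by rewrite /qpoch big_ord_recr. Qed.

Lemma qpochD (a c : Cx R) m n :
  qpoch a c (m + n) = qpoch a c m * qpoch (a * c ^+ m) c n.
Proof.
elim: n => [|n IH]; first by rewrite addn0 qpoch0 mulr1.
by rewrite addnS !qpochS IH exprD !mulrA.
Qed.

Lemma qpochbS n : pb n.+1 = pb n * (1 - b ^+ n.+1).
Proof. by rewrite qpochS -exprS. Qed.

Lemma qpochb_neq0 n : pb n != 0.
Proof.
elim: n => [|n IH]; first by rewrite qpoch0 oner_neq0.
by rewrite qpochbS mulf_neq0.
Qed.

Lemma bin2S m : ('C(m.+1, 2) = 'C(m, 2) + m)%N.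
Proof. by rewrite binS bin1. Qed.

(* The q-Chu-Vandermonde sum with the parameters chosen so that no division by X
   or B occurs: X = 0 is Euler's identity, B = 0 is q-Vandermonde, and N -> oo
   is the limiting q-Gauss sum. *)
Lemma q_chu_vandermonde N (X B : Cx R) :
  \sum_(m < N.+1) b ^+ 'C(m, 2) * (\prod_(k < m) (X * b ^+ k - B))
     * qpoch (X * b ^+ m) b (N - m) / (pb m * pb (N - m))
  = qpoch B b N / pb N.
Proof.
elim: N X => [|N IH] X.
  by rewrite big_ord1 /= big_ord0 subnn !qpoch0 expr0 !mulr1.
apply: (mulfI (b1 N)); rewrite mulr_sumr.
(* Split 1 - b^(N+1) as (1 - b^(N+1-m)) + b^(N+1-m) (1 - b^m). The first part loses its top term and
   is the case N at X; the second loses its bottom term and is the case N at X b. The prefactors add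
   up to (1 - X b^N) + b^N (X - B) = 1 - B b^N. *)
pose A (m : nat) := b ^+ 'C(m, 2) * (\prod_(k < m) (X * b ^+ k - B))
   * qpoch (X * b ^+ m) b (N.+1 - m) / (pb m * pb (N.+1 - m))
   * (1 - b ^+ (N.+1 - m)).
pose D (m : nat) := b ^+ 'C(m, 2) * (\prod_(k < m) (X * b ^+ k - B))
   * qpoch (X * b ^+ m) b (N.+1 - m) / (pb m * pb (N.+1 - m))
   * (b ^+ (N.+1 - m) * (1 - b ^+ m)).
rewrite (eq_bigr (fun m : 'I_(N.+2) => A m + D m)); last first.
  move=> m _; rewrite /A /D -mulrDr mulrC; congr (_ * _).
  have -> : b ^+ N.+1 = b ^+ (N.+1 - m) * b ^+ m by rewrite -exprD subnK // -ltnS.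
  by ring.
rewrite big_split /= big_ord_recr /= [X in _ + X]big_ord_recl /=.
have -> : A N.+1 = 0 by rewrite /A subnn expr0 subrr mulr0.
have -> : D 0%N = 0 by rewrite /D expr0 subrr !mulr0.
rewrite addr0 add0r.
have -> : \sum_(i < N.+1) A i = (1 - X * b ^+ N) * (qpoch B b N / pb N).
  rewrite -(IH X) mulr_sumr; apply: eq_bigr => -[m /= lt_mN] _; rewrite /A.
  rewrite subSn // qpochS qpochbS.
  have -> : b ^+ N = b ^+ m * b ^+ (N - m) by rewrite -exprD subnKC.
  have := qpochb_neq0 m; have := qpochb_neq0 (N - m); have := b1 (N - m) => *.
  by field; apply/and3P.
have -> : \sum_(i < N.+1) D (lift ord0 i) =
    b ^+ N * (X - B) * (qpoch B b N / pb N).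
  rewrite -(IH (X * b)) mulr_sumr; apply: eq_bigr => -[m /= lt_mN] _; rewrite /D.
  rewrite /bump /= add1n subSS bin2S big_ord_recl /= expr0 mulr1 qpochbS.
  under eq_bigr => k _ do rewrite /bump /= add1n exprS mulrA.
  rewrite -[X * b * b ^+ m]mulrA -exprS exprD.
  have -> : b ^+ N = b ^+ m * b ^+ (N - m) by rewrite -exprD subnKC.
  by have := qpochb_neq0 m; have := qpochb_neq0 (N - m); have := b1 m => *; field; apply/and3P.
rewrite qpochS qpochbS.
by have := qpochb_neq0 N; have := b1 N => *; field; apply/andP.
Qed.

Definition tri (z : int) : int := ((z * (z - 1)) %/ 2)%Z.

Lemma triE z : tri z * 2 = z * (z - 1).
Proof.
have ev (k : nat) : (2 %| (k * k.+1)%N%:Z)%Z by rewrite dvdzE dvdn2 oddM /= andbN.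
rewrite /tri divzK //; case: z => [[|n]|n] //.
  by have -> : Posz n.+1 * (Posz n.+1 - 1) = (n * n.+1)%N by lia.
by have -> : Negz n * (Negz n - 1) = (n.+1 * n.+2)%N by lia.
Qed.

Lemma tri_nat (n : nat) : tri n = 'C(n, 2) :> int.
Proof.
have := triE n; elim: n => [|n IH]; first by move=> _.
have := triE n => Hn; have {}IH := IH Hn; rewrite bin2S => H; lia.
Qed.

(* 1 / (b;b)_z, with the usual convention that it vanishes for z < 0. *)
Definition qfact_inv (z : int) : Cx R := if z is Posz n then (pb n)^-1 else 0.

Local Notation ip := qfact_inv.

(** At z = -1 both sides vanish because of the factor 1 - b^0, so the convention for negative z is
    compatible with the recurrence. *)
Lemma qfact_inv_step z : ip z = (1 - b ^ (z + 1)) * ip (z + 1).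
Proof.
case: z => [n|[|n]]; last by rewrite NegzE /= mulr0.
  rewrite -PoszD addn1 /= qpochbS invfM mulrCA divff ?mulr1 ?b1 //.
by rewrite /= expr0z subrr mul0r.
Qed.

(** The case [B = 0], [X = b^(c+1)] of [q_chu_vandermonde]: the product starting at X b^t begins
    where (b;b)_(t+c) stops, hence is (b;b)_(N+c) / (b;b)_(t+c). *)
Lemma q_vandermonde_nat c N :
  \sum_(t < N.+1) b ^+ (t * t + c * t) / (pb (N - t) * pb t * pb (t + c))
  = (pb N * pb (N + c))^-1.
Proof.
have := q_chu_vandermonde N (b ^+ c.+1) 0.
have -> : qpoch 0 b N = 1 by rewrite /qpoch big1 // => k _; rewrite mul0r subr0.
move=> H; rewrite invfM -[_^-1]mul1r -H mulr_suml; apply: eq_bigr => -[t /= lt_tN] _.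
have -> : \prod_(k < t) (b ^+ c.+1 * b ^+ k - 0) = b ^+ (c.+1 * t + 'C(t, 2)).
  elim: t {lt_tN} => [|t IH]; first by rewrite big_ord0 muln0 expr0.
  rewrite big_ord_recr /= IH subr0 -!exprD bin2S; congr (b ^+ _); lia.
have -> : qpoch (b ^+ c.+1 * b ^+ t) b (N - t) = pb (N + c) / pb (t + c).
  have -> : (N + c = (t + c) + (N - t))%N by lia.
  rewrite (qpochD _ _ (t + c)) -exprS -exprD mulrAC divff ?qpochb_neq0 // mul1r.
  by congr (qpoch (b ^+ _) _ _); lia.
have -> : (t * t + c * t = 'C(t, 2) + (c.+1 * t + 'C(t, 2)))%N.
  have := triE t; rewrite tri_nat; nia.
rewrite exprD.
have := qpochb_neq0 t; have := qpochb_neq0 (N - t).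
have := qpochb_neq0 (t + c); have := qpochb_neq0 (N + c) => *.
by field; apply/and4P.
Qed.

Hypothesis b0 : b != 0.

(** The kernel reproduces itself, which is the engine of the Bailey lemma. The reflection r -> -r-e
    swaps its two factors and sends negative r to r >= 0 as e <= 1; then m = t + r reduces to
    [q_vandermonde_nat] with c = 2r + e. *)
Lemma q_vandermonde_int (e n : nat) (r : int) : (e <= 1)%N ->
  \sum_(m < n.+1) b ^ (m%:Z * m%:Z + e%:Z * m%:Z) / pb (n - m)
     * (ip (m%:Z - r) * ip (m%:Z + r + e%:Z))
  = b ^ (r * r + e%:Z * r) * (ip (n%:Z - r) * ip (n%:Z + r + e%:Z)).
Proof.
move=> le1; wlog [k ->] : r / exists k : nat, r = k.
  move=> H; case: r => k; first by apply: H; exists k.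
  have /H : exists k' : nat, - Negz k - e%:Z = k' by exists (k.+1 - e)%N; lia.
  set r := Negz k; move=> {}H.
  rewrite (_ : r * r + e%:Z * r = (- r - e%:Z) * (- r - e%:Z) + e%:Z * (- r - e%:Z)); last by ring.
  rewrite (_ : n%:Z - r = n%:Z + (- r - e%:Z) + e%:Z); last by ring.
  rewrite (_ : n%:Z + r + e%:Z = n%:Z - (- r - e%:Z)); last by ring.
  rewrite [X in _ = _ * X]mulrC -H; apply: eq_bigr => m _; rewrite [X in _ = _ * X]mulrC.
  by congr (_ * (ip _ * ip _)); ring.
have ipN (m l : nat) : (m < l)%N -> ip (m%:Z - l%:Z) = 0.
  move=> lt; have -> : m%:Z - l%:Z = Negz (l - m).-1 by lia.
  by [].
have [lt_nk|le_kn] := ltnP n k.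
  rewrite ipN // mul0r mulr0; apply: big1 => -[m /= lt_mn] _.
  by rewrite ipN ?mul0r ?mulr0 //; lia.
rewrite (@sum_drop _ (fun m : nat => b ^ (m%:Z * m%:Z + e%:Z * m%:Z) / pb (n - m)
     * (ip (m%:Z - k%:Z) * ip (m%:Z + k%:Z + e%:Z))) k) //; last first.
  by move=> m lt; rewrite ipN // mul0r mulr0.
have -> : (k%:Z * k%:Z + e%:Z * k%:Z) = (k * k + e * k)%N by lia.
have -> : n%:Z - k%:Z = (n - k)%N by lia.
have -> : n%:Z + k%:Z + e%:Z = (n - k + (k + k + e))%N by lia.
rewrite -[X in _ * X]/((pb _)^-1 * (pb _)^-1) -invfM -q_vandermonde_nat.
rewrite mulr_sumr.
apply: eq_bigr => i _; move: (nat_of_ord i) (ltn_ord i) => {i} t lt_t.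
have -> : (t + k)%:Z - k%:Z = t by lia.
have -> : (t + k)%:Z + k%:Z + e%:Z = (t + (k + k + e))%N by lia.
have -> : (t + k)%:Z * (t + k)%:Z + e%:Z * (t + k)%:Z =
  (k * k + e * k + (t * t + (k + k + e) * t))%N by lia.
have -> : (n - (t + k) = n - k - t)%N by lia.
rewrite -!exprnP /= (exprD _ (k * k + e * k)) -!invfM -!mulrA -!invfM.
by [].
Qed.

(* The kernel of a Bailey pair relative to a = b^e, symmetric under r -> -r-e. *)
Definition bailey_term (e n : nat) (r : int) : Cx R := ip (n%:Z - r) * ip (n%:Z + r + e%:Z).

Lemma bailey_term_pos (e n r : nat) : (n < r)%N -> bailey_term e n r = 0.
Proof.
move=> lt; rewrite /bailey_term; have -> : n%:Z - r%:Z = Negz (r - n).-1 by lia.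
by rewrite mul0r.
Qed.

Lemma bailey_term_neg (e n r : nat) : (n + e <= r)%N -> bailey_term e n (Negz r) = 0.
Proof.
move=> lt; rewrite /bailey_term; have -> : n%:Z + Negz r + e%:Z = Negz (r - n - e) by lia.
by rewrite mulr0.
Qed.

(** For e = 0 the kernel is even in r and tri(r+1) = tri(-r), so d = 0 and d = 1 give equal sums
    with different coefficients; both forms are needed later. For n > 0 the sum vanishes as a finite
    product containing the factor 1 - b^0. *)
Lemma unit_bailey_pair (e d n N : nat) : (e + d <= 1)%N -> (n < N)%N ->
  bisum N (fun r => (-1) ^ r * b ^ tri (r + d%:Z) * bailey_term e n r) = (n == 0)%:R.
Proof.
move=> le1 ltnN; rewrite (@bisum_shift _ _ n e) //; try lia; last 2 first.
- by move=> r lt; rewrite bailey_term_pos ?mulr0.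
- by move=> r lt; rewrite bailey_term_neg ?mulr0.
case: n ltnN => [|n] ltnN.
  rewrite eqxx; case: e le1 => [|[|//]] le1; last first.
    have -> : d = 0%N by lia.
    rewrite big_ord_recr big_ord1 /= /bailey_term /= !qpochbS !qpoch0 expr1.
    have -> : tri (Posz 0 - Posz 1 + Posz 0) = 1 by [].
    have -> : tri (Posz 1 - Posz 1 + Posz 0) = 0 by [].
    have -> : (0%:Z - (0 + 1)%N%:Z) = -1 by [].
    have -> : ((0 + 0 + 1)%N%:Z - (0 + 1)%N%:Z) = 0 by [].
    rewrite exprN1 invrN1 expr1z !expr0z.
    by have := b1 0; rewrite expr1 => b10; field.
  rewrite big_ord1 /= /bailey_term /= qpoch0 invr1 subrr expr0z !mul1r mulr1.
  by have -> : tri (0 + d%:Z) = 0 by (case: d le1 => [|[|]]).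
(* With s the shifted index, r + d = s - L, and s runs up to M. Since tri(s-L) = C(s,2) - L s +
   tri(L+1), this is Euler's case with B = b^-L, and (b^-L; b)_M = 0 because L < M. *)
set L := (n.+1 + e - d)%N; set M := (n.+1 + n.+1 + e)%N.
have qM0 : qpoch (b ^ (- L%:Z)) b M = 0.
  have ltLM : (L < M)%N by lia.
  rewrite /qpoch (bigD1 (Ordinal ltLM)) //= [b ^+ L]exprnP -expfzDr // addNr expr0z subrr.
  by rewrite mul0r.
have := q_chu_vandermonde M 0 (b ^ (- L%:Z)); rewrite qM0 mul0r => H.
apply: etrans _ (mulr0 ((-1) ^ (- (n.+1 + e)%N%:Z) * b ^ tri (L%:Z + 1))).
rewrite -[in RHS]H mulr_sumr.
apply: eq_bigr => i _; move: (nat_of_ord i) (ltn_ord i) => {i} s lt_s.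
have -> : \prod_(k < s) (0 * b ^+ k - b ^ (- L%:Z)) = (-1) ^ s%:Z * b ^ (- L%:Z * s).
  under eq_bigr => k _ do rewrite mul0r sub0r -mulN1r.
  by rewrite prodr_const card_ord exprMn -exprz_exp.
have -> : qpoch (0 * b ^+ s) b (M - s) = 1.
  by rewrite mul0r /qpoch big1 // => k _; rewrite mul0r subr0.
have -> : bailey_term e n.+1 (s%:Z - (n.+1 + e)%N%:Z) = (pb s * pb (M - s))^-1.
  rewrite /bailey_term; have -> : n.+1%:Z - (s%:Z - (n.+1 + e)%N%:Z) = (M - s)%N by lia.
  have -> : n.+1%:Z + (s%:Z - (n.+1 + e)%N%:Z) + e%:Z = s by lia.
  by rewrite /= invfM mulrC.
have -> : tri (s%:Z - (n.+1 + e)%N%:Z + d%:Z) = 'C(s, 2)%:Z + (- L%:Z * s) + tri (L%:Z + 1).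
  have := triE (s%:Z - (n.+1 + e)%N%:Z + d%:Z); have := triE s; rewrite tri_nat.
  have := triE (L%:Z + 1).
  have -> : s%:Z - (n.+1 + e)%N%:Z + d%:Z = s%:Z - L%:Z by lia.
  nia.
rewrite !(expfzDr _ _ b0) (@expfzDr _ (-1)) ?oppr_eq0 ?oner_eq0 // [b ^+ 'C(s, 2)]exprnP.
ring.
Qed.

(** This is the Bailey lemma with both free parameters sent to infinity; it is linear in [g], so
    exchanging the sums leaves [q_vandermonde_int] for each r. *)
Lemma bailey_step (e N : nat) (c : int -> Cx R) (g : nat -> Cx R) :
  (e <= 1)%N ->
  (forall n, (n < N)%N -> g n = bisum N (fun r => c r * bailey_term e n r)) ->
  forall n, (n < N)%N ->
    \sum_(m < n.+1) b ^ (m%:Z * m%:Z + e%:Z * m%:Z) / pb (n - m) * g m =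
    bisum N (fun r => c r * b ^ (r * r + e%:Z * r) * bailey_term e n r).
Proof.
move=> le1 gE n ltnN.
rewrite (eq_bigr (fun m : 'I_n.+1 => b ^ (m%:Z * m%:Z + e%:Z * m%:Z) / pb (n - m) *
  bisum N (fun r => c r * bailey_term e m r))); last first.
  by move=> m _; rewrite gE //; have := ltn_ord m; lia.
under eq_bigr => m _ do rewrite mulr_sumr.
rewrite exchange_big /=; apply: eq_bigr => r _.
under eq_bigr => m _ do rewrite mulrDr.
rewrite big_split /=; congr (_ + _); rewrite -[RHS]mulrA /bailey_term -q_vandermonde_int // mulr_sumr;
  by apply: eq_bigr => m _; rewrite mulrCA.
Qed.

Definition beta (e n : nat) : Cx R :=
  \sum_(m < n.+1) b ^ (m%:Z * m%:Z + e%:Z * m%:Z) / pb (n - m) / pb m.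

(** The coefficient of the unit pair times b^(r^2 + er) for each of two Bailey steps. *)
Definition bailey_coef (e d : nat) (r : int) : Cx R :=
  (-1) ^ r * b ^ (tri (r + d%:Z) + 2 * (r * r + e%:Z * r)).

Lemma beta_bailey_pair (e d n N : nat) : (e + d <= 1)%N -> (n < N)%N ->
  beta e n = bisum N (fun r => bailey_coef e d r * bailey_term e n r).
Proof.
move=> le1 ltnN; have lee : (e <= 1)%N by lia.
have H0 := unit_bailey_pair le1.
have H1 := bailey_step lee (fun n lt => esym (H0 n N lt)).
(* First step: against the unit pair only the term m = 0 survives, leaving 1/(b;b)_m, the last
   factor in the definition of [beta]. *)
have H1' m : (m < N)%N -> (pb m)^-1 = bisum N (fun r => (-1) ^ r * b ^ tri (r + d%:Z) *
    b ^ (r * r + e%:Z * r) * bailey_term e m r).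
  move=> lt; rewrite -H1 // big_ord_recl /= big1 ?addr0 => [|i _]; last by rewrite mulr0.
  by rewrite !mulr0 addr0 expr0z subn0 mul1r mulr1.
rewrite /beta (bailey_step lee H1') //; apply: eq_bigr => r _.
have E z : (-1) ^ z * b ^ tri (z + d%:Z) * b ^ (z * z + e%:Z * z) * b ^ (z * z + e%:Z * z)
    = bailey_coef e d z.
  by rewrite /bailey_coef -!mulrA -!expfzDr //; congr (_ * b ^ _); ring.
by rewrite !E.
Qed.

(* The pair relative to a = b, read as a pair relative to a = 1: the difference
   of the two kernels is antisymmetric under r -> -1-r. *)
Lemma beta_bailey_pair_shift (n N : nat) : (n < N)%N ->
  beta 1 n = bisum N (fun r => bailey_coef 1 0 r * bailey_term 0 n r).
Proof.
move=> ltnN; rewrite (@beta_bailey_pair 1 0 n N) //; apply/eqP; rewrite -subr_eq0.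
rewrite /bisum -sumrB; apply/eqP; apply: big1 => r _.
(* The difference of the two kernels is b^(n+r+1) times the kernel for e = 1. Passing from r to -1-r
   turns this power into b^(n-r) and multiplies the coefficient by -b^(2r+1), so the two
   contributions cancel. *)
have E z : bailey_term 0 n z = (1 - b ^ (n%:Z + z + 1)) * bailey_term 1 n z.
  by rewrite /bailey_term mulrCA addr0 (qfact_inv_step (n%:Z + z)).
rewrite !{}E.
have -> : bailey_term 1 n (Negz r) = bailey_term 1 n (Posz r).
  by rewrite /bailey_term mulrC; congr (ip _ * ip _); rewrite NegzE; lia.
have -> : bailey_coef 1 0 (Negz r) = - (bailey_coef 1 0 r) * b ^ (r%:Z + r%:Z + 1).
  rewrite /bailey_coef mulNr -mulrA -expfzDr // -mulNr; congr (_ * b ^ _).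
    by rewrite NegzE -exprnN -exprnP exprS mulN1r invrN -exprVn invrN1.
  rewrite !addr0; have := triE (Negz r); have := triE r; rewrite NegzE; nia.
have -> : n%:Z + r%:Z + 1 = (n%:Z + Negz r + 1) + (r%:Z + r%:Z + 1) by lia.
rewrite (expfzDr (n%:Z + Negz r + 1) _ b0); ring.
Qed.

End FiniteIdentities.

(** * Dominated series of complex numbers *)

Section Analysis.
Variable R : realType.
Local Notation K := (Cx R).
Implicit Types (f g : nat -> K) (M rho s : K).

Definition has_sum f s := (fun N => \sum_(k < N) f k) @ \oo --> s.

Lemma Cx_cvg_unique (u : nat -> K) (l l' : K) :
  u @ \oo --> l -> u @ \oo --> l' -> l = l'.
Proof. by apply: cvg_unique; exact: norm_hausdorff. Qed.

Lemma norm_realC (x : R) : `|(x%:C)%C : K| = (`|x|%:C)%C.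
Proof. by rewrite normc_def /= expr0n /= addr0 sqrtr_sqr. Qed.

(** In the partial order on complex numbers 0 <= x forces x to be real. Majorants and tolerances can
    thus stay complex and are pulled back to the reals only where real analysis enters. *)
Lemma ge0_realC (x : K) : 0 <= x -> exists2 y : R, 0 <= y & x = (y%:C)%C.
Proof.
move=> x0; have /complex_realP[y xE] := ger0_real x0.
by exists y => //; rewrite -ler0c -xE.
Qed.

Lemma cvg_realC (u : nat -> R) (l : R) :
  u @ \oo --> l -> (fun n => ((u n)%:C)%C : K) @ \oo --> ((l%:C)%C : K).
Proof.
move=> /cvgrPdist_lt ul; apply/cvgrPdist_lt => e e0.
have [d d0 eE] := ge0_realC (ltW e0); rewrite eE in e0 *.
have {}d0 : 0 < d by rewrite -ltcR.
have := ul _ d0; apply: filterS => n; rewrite -ltcR -norm_realC.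
by rewrite rmorphB.
Qed.

Lemma geo_cvg0 M rho (e : K) : 0 <= M -> 0 <= rho < 1 -> 0 < e ->
  exists n, M * rho ^+ n / (1 - rho) < e.
Proof.
move=> M0 /andP[r0 r1] e0.
have [m m0 mE] := ge0_realC M0; have [r r0' rE] := ge0_realC r0.
have [d d0 dE] := ge0_realC (ltW e0).
have {}d0 : 0 < d by rewrite -ltcR -dE.
have {}r1 : r < 1 by rewrite -ltcR -rE.
have nr1 : `|r| < 1 by rewrite ger0_norm.
have C : (fun n => m / (1 - r) * r ^+ n) @ \oo --> m / (1 - r) * 0.
  by apply: cvgMr; exact: cvg_expr.
have := (cvgrPdist_lt _ _).1 C _ d0; rewrite mulr0 => -[n _ /(_ n (leqnn n))] /=.
rewrite sub0r normrN => lt; exists n; rewrite mE rE dE.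
have -> : (m%:C)%C * (r%:C)%C ^+ n / (1 - (r%:C)%C) = ((m / (1 - r) * r ^+ n)%:C)%C :> K.
  by rewrite !(rmorphM, fmorphV, rmorphB, rmorphXn, rmorph1) /= mulrAC.
by rewrite ltcR; apply: le_lt_trans lt; exact: ler_norm.
Qed.

Lemma geo_tail M rho f m n : 0 <= M -> 0 <= rho < 1 ->
  (forall k, `|f k| <= M * rho ^+ k) ->
  `|\sum_(m <= k < n) f k| <= M * rho ^+ m / (1 - rho).
Proof.
move=> M0 /andP[r0 r1] fM; have r1' : 0 < 1 - rho by rewrite subr_gt0.
have [le_nm|/ltnW le_mn] := leqP n m.
  by rewrite big_geq // normr0 divr_ge0 ?mulr_ge0 ?exprn_ge0 // ltW.
apply: le_trans (ler_norm_sum _ _ _) _.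
apply: le_trans (_ : \sum_(m <= k < n) M * rho ^+ k <= _).
  by apply: ler_sum => k _; apply: fM.
rewrite ler_pdivlMr // mulr_suml.
have -> : \sum_(m <= i < n) M * rho ^+ i * (1 - rho) =
    - \sum_(m <= i < n) (M * rho ^+ i.+1 - M * rho ^+ i).
  by rewrite -sumrN; apply: eq_bigr => i _; rewrite exprS; ring.
rewrite (telescope_sumr (fun i => M * rho ^+ i)) // opprB gerBl.
by rewrite mulr_ge0 ?exprn_ge0.
Qed.

Lemma cvg_bound (u : nat -> K) (l B : K) :
  (forall n, `|u n| <= B) -> u @ \oo --> l -> `|l| <= B.
Proof.
move=> uB ul; have B0 : 0 <= B by apply: le_trans (uB 0%N).
rewrite real_leNgt ?ger0_real //; apply/negP => ltB.
have e0 : 0 < `|l| - B by rewrite subr_gt0.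
have [n _ /(_ n (leqnn n)) /=] := (cvgrPdist_lt _ _).1 ul _ e0.
rewrite ltrBrDr => H; have := lt_le_trans H (lexx _).
apply/negP; rewrite -real_leNgt ?ger0_real ?addr_ge0 //.
by apply: le_trans (lerD (lexx _) (uB n)); rewrite -{1}[l](subrK (u n)) ler_normD.
Qed.

(* Completeness of the complex numbers enters only here, through the real and
   imaginary parts. *)
Lemma Cx_series_cvg M rho f : 0 <= M -> 0 <= rho < 1 ->
  (forall k, `|f k| <= M * rho ^+ k) -> exists s, has_sum f s.
Proof.
move=> M0 /andP[r0 r1] fM.
have [m m0 mE] := ge0_realC M0; have [r r0' rE] := ge0_realC r0.
have nr1 : `|r| < 1 by rewrite ger0_norm // -ltcR -rE.
have real_cvg (g : nat -> R) : (forall k, (`|g k|%:C)%C <= `|f k|) ->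
    exists l : R, (fun N => \sum_(k < N) g k) @ \oo --> l.
  move=> gf; have : cvgn (series g).
    apply: normed_cvg; apply: (@series_le_cvg _ _ (geometric m r)).
    - by move=> n; exact: normr_ge0.
    - by move=> n; rewrite /= mulr_ge0 // exprn_ge0.
    - move=> n /=; rewrite -lecR rmorphM rmorphXn /= -mE -rE.
      exact: le_trans (gf n) (fM n).
    - exact: is_cvg_geometric_series.
  move=> /cvg_ex[l lP]; exists l; rewrite (_ : (fun _ => _) = series g) //.
  by apply/funext => N; rewrite /series /= big_mkord.
have [x xP] := real_cvg (fun k => complex.Re (f k)) (fun k => normc_ge_Re (f k)).
have imle k : (`|complex.Im (f k)|%:C)%C <= `|f k|.
  have := normc_ge_Re (f k * 'i%C); rewrite ReiNIm normrN normrM.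
  by rewrite [`|'i%C|]normc_def /= expr0n expr1n add0r sqrtr1 mulr1.
have [y yP] := real_cvg (fun k => complex.Im (f k)) imle.
exists ((x%:C)%C + 'i%C * (y%:C)%C).
rewrite /has_sum (_ : (fun N => _) = (fun N => ((\sum_(k < N) complex.Re (f k))%:C)%C
    + 'i%C * ((\sum_(k < N) complex.Im (f k))%:C)%C)).
  exact: (cvgD (cvg_realC xP) (cvgM (cvg_cst ('i%C : K)) (cvg_realC yP))).
apply/funext => N; rewrite !raddf_sum /= mulr_sumr -big_split /=; apply: eq_bigr => k _.
exact: complexE.
Qed.

Lemma cvg_sum_ord n (F : nat -> nat -> K) g :
  (forall k, (F^~ k) @ \oo --> g k) ->
  (fun N => \sum_(k < n) F N k) @ \oo --> \sum_(k < n) g k.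
Proof.
move=> Fg; elim: n => [|n IH].
  rewrite big_ord0; under eq_fun do rewrite big_ord0; exact: cvg_cst.
rewrite big_ord_recr; under eq_fun do rewrite big_ord_recr.
exact: (cvgD IH (Fg n)).
Qed.

(** The same s is the sum of the limits and the limit of the sums; in applications s is then found
    from a closed form of the finite sums. The length [L N] allows ranges such as N + 1 and N +
    N. *)
Lemma tannery M rho (L : nat -> nat) (F : nat -> nat -> K) g :
  0 <= M -> 0 <= rho < 1 -> (forall N, (N <= L N)%N) ->
  (forall N k, `|F N k| <= M * rho ^+ k) ->
  (forall k, (F^~ k) @ \oo --> g k) ->
  exists2 s, has_sum g s & (fun N => \sum_(k < L N) F N k) @ \oo --> s.
Proof.
move=> M0 r01 LN FM Fg.
have gM k : `|g k| <= M * rho ^+ k by apply: cvg_bound (Fg k) => N; apply: FM.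
have [s gs] := Cx_series_cvg M0 r01 gM; exists s => //.
apply/cvgrPdist_lt => e e0; have e4 : 0 < e / 4 by rewrite divr_gt0.
have [n0 n0P] := geo_cvg0 M0 r01 e4.
have near1 : \forall N \near \oo, `|s - \sum_(k < N) g k| < e / 4.
  exact: (cvgrPdist_lt _ _).1 gs _ e4.
have near2 : \forall N \near \oo, `|\sum_(k < n0) g k - \sum_(k < n0) F N k| < e / 4.
  exact: (cvgrPdist_lt _ _).1 (@cvg_sum_ord n0 _ _ Fg) _ e4.
near=> N.
have leN : (n0 <= N)%N by near: N; exact: nbhs_infty_ge.
have split_sum (h : nat -> K) n : (n0 <= n)%N ->
    \sum_(k < n) h k = \sum_(k < n0) h k + \sum_(n0 <= k < n) h k.
  by move=> le; rewrite -!(big_mkord xpredT h) -big_cat_nat.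
have H1 : `|s - \sum_(k < N) g k| < e / 4 by near: N.
have H2 : `|\sum_(k < n0) g k - \sum_(k < n0) F N k| < e / 4 by near: N.
have H3 := geo_tail n0 N M0 r01 gM.
have H4 := geo_tail n0 (L N) M0 r01 (FM N).
have -> : s - \sum_(k < L N) F N k = (s - \sum_(k < N) g k) +
   (\sum_(k < n0) g k - \sum_(k < n0) F N k) + \sum_(n0 <= k < N) g k
   - \sum_(n0 <= k < L N) F N k.
  rewrite (split_sum (F N)) ?(leq_trans leN) // (split_sum g N) //; ring.
have -> : e = e / 4 + e / 4 + e / 4 + e / 4 by field.
apply: le_lt_trans (ler_normB _ _) _; apply: ltrD; last exact: le_lt_trans H4 n0P.
apply: le_lt_trans (ler_normD _ _) _; apply: ltrD; last exact: le_lt_trans H3 n0P.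
by apply: le_lt_trans (ler_normD _ _) _; apply: ltrD.
Unshelve. all: by end_near.
Qed.

End Analysis.

(** * Infinite products *)

Section InfiniteProducts.
Variable R : realType.
Local Notation K := (Cx R).
Implicit Types (a b x y z M rho : K).

(** From 1 + x <= exp x and the geometric series, exp(A/(1-rho)) works for all n and all [h] at
    once. *)
Lemma prod_bound A rho : 0 <= A -> 0 <= rho < 1 -> exists2 M : K, 0 <= M &
  forall (h : nat -> K) n, (forall k, `|h k| <= 1 + A * rho ^+ k) ->
    `|\prod_(k < n) h k| <= M.
Proof.
move=> A0 r01; have /andP[r0 r1] := r01.
have [a a0 aE] := ge0_realC A0; have [r r0' rE] := ge0_realC r0.
exists ((expR (a / (1 - r)))%:C)%C; first by rewrite ler0c expR_ge0.
move=> h n hb; rewrite normr_prod.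
have arC k : A * rho ^+ k = ((a * r ^+ k)%:C)%C by rewrite aE rE rmorphM rmorphXn.
apply: le_trans (_ : ((expR (\sum_(k < n) a * r ^+ k))%:C)%C <= _); last first.
  rewrite lecR ler_expR -lecR.
  have -> : ((a / (1 - r))%:C)%C = A * rho ^+ 0 / (1 - rho).
    by rewrite aE rE expr0 mulr1 !(rmorphM, fmorphV, rmorphB, rmorph1).
  have f_le k : `|A * rho ^+ k| <= A * rho ^+ k by rewrite ger0_norm // mulr_ge0 ?exprn_ge0.
  have := geo_tail 0 n A0 r01 f_le; rewrite big_mkord; apply: le_trans.
  rewrite rmorph_sum /= (eq_bigr (fun k : 'I_n => A * rho ^+ k)) => [|k _]; last by rewrite -arC.
  by apply: real_ler_norm; apply: ger0_real; apply: sumr_ge0 => k _; rewrite mulr_ge0 ?exprn_ge0.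
elim: n => [|n IH]; first by rewrite !big_ord0 expR0.
rewrite !big_ord_recr /= expRD rmorphM /=; apply: ler_pM => //.
  by apply: prodr_ge0.
apply: le_trans (hb n) _; rewrite arC -(rmorph1 (real_complex R)) -rmorphD lecR.
exact: expR_ge1Dx.
Qed.

Lemma qpoch_bound b A : `|b| < 1 -> 0 <= A -> exists2 M : K, 0 <= M &
  forall a n, `|a| <= A -> `|qpoch a b n| <= M.
Proof.
move=> b1 A0; have [|M M0 MP] := @prod_bound A `|b| A0; first by rewrite normr_ge0.
exists M => // a n aA; apply: (MP (fun k => 1 - a * b ^+ k)) => k.
by rewrite (le_trans (ler_normB _ _)) // normr1 normrM normrX lerD2l ler_wpM2r // exprn_ge0.
Qed.

Lemma subr1X_neq0 b n : `|b| < 1 -> 1 - b ^+ n.+1 != 0.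
Proof.
move=> b1; rewrite subr_eq0; apply/eqP => E.
have := exprn_ilt1 n.+1 (normr_ge0 b) b1.
by rewrite -normrX -E normr1 ltxx.
Qed.

Lemma qpoch_inv_bound b : `|b| < 1 -> exists2 M : K, 0 <= M &
  forall n, `|(qpoch b b n)^-1| <= M.
Proof.
move=> b1; have b1' : 0 < 1 - `|b| by rewrite subr_gt0.
(* The constant comes from 1/(1-t) = 1 + t/(1-t) with t = |b|^(k+1) <= |b|. *)
have [||M M0 MP] := @prod_bound (`|b| / (1 - `|b|)) `|b|.
- by rewrite divr_ge0 // ltW.
- by rewrite normr_ge0.
exists M => // n; rewrite /qpoch -prodfV.
apply: (MP (fun k => (1 - b * b ^+ k)^-1)) => k.
have bk : `|b| ^+ k.+1 <= `|b|.
  by rewrite exprS; apply: ler_piMr => //; apply: exprn_ile1 => //; exact: ltW.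
have bk1 : 0 < 1 - `|b| ^+ k.+1 by rewrite subr_gt0 (le_lt_trans bk).
rewrite -exprS normrV; last by rewrite unitfE subr1X_neq0.
apply: le_trans (_ : (1 - `|b| ^+ k.+1)^-1 <= _).
  rewrite lef_pV2 ?posrE //; last by rewrite normr_gt0 subr1X_neq0.
  by rewrite -normrX -[X in X - _](@normr1 K) lerB_dist.
rewrite -div1r ler_pdivrMr // mulrAC -exprS.
rewrite mulrDl mul1r -lerBlDl opprB addrCA subrr addr0.
rewrite mulrAC ler_pdivlMr //; apply: ler_wpM2l; first by rewrite exprn_ge0.
by rewrite lerB.
Qed.

(** The partial products are 1 plus a telescoping series whose terms -(a;b)_k a b^k decay
    geometrically. This makes the [lim] in [qpoch_inf] a genuine limit. *)
Lemma qpoch_cvg a b : `|b| < 1 -> qpoch a b @ \oo --> qpoch_inf a b.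
Proof.
move=> b1; have [M M0 MP] := qpoch_bound b1 (normr_ge0 a).
have [|||s sP] := @Cx_series_cvg R (M * `|a|) `|b| (fun k => - (qpoch a b k * (a * b ^+ k))).
- by rewrite mulr_ge0.
- by rewrite normr_ge0 b1.
- by move=> k; rewrite normrN !normrM normrX mulrA !ler_wpM2r ?exprn_ge0 ?MP.
have : qpoch a b @ \oo --> 1 + s.
  rewrite (_ : qpoch a b = (fun N => 1 + \sum_(k < N) - (qpoch a b k * (a * b ^+ k)))).
    exact: (cvgD (cvg_cst (1 : K)) sP).
  apply/funext; elim=> [|N IH]; first by rewrite big_ord0 addr0 qpoch0.
  by rewrite big_ord_recr /= addrA -IH qpochS mulrBr mulr1.
move=> H; rewrite /qpoch_inf; have := cvg_lim (@norm_hausdorff _ _) H; rewrite /= => E.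
by rewrite [X in _ --> X]E.
Qed.

Lemma qpoch_infD a b n : `|b| < 1 -> qpoch_inf a b = qpoch a b n * qpoch_inf (a * b ^+ n) b.
Proof.
move=> b1; have H1 := @qpoch_cvg a b b1; rewrite -(cvg_shiftn n) /= in H1.
apply: Cx_cvg_unique H1 _.
rewrite (_ : (fun _ => _) = (fun N => qpoch a b n * qpoch (a * b ^+ n) b N)).
  exact: (cvgM (cvg_cst _) (@qpoch_cvg _ b b1)).
by apply/funext => N; rewrite addnC qpochD.
Qed.

Lemma qpoch_inf0 b : `|b| < 1 -> qpoch_inf 0 b = 1.
Proof.
move=> b1; apply: Cx_cvg_unique (@qpoch_cvg 0 b b1) _.
rewrite (_ : qpoch 0 b = fun=> 1); first exact: cvg_cst.
by apply/funext => N; rewrite /qpoch big1 // => k _; rewrite mul0r subr0.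
Qed.

(** A zero limit would make the reciprocals of the partial products unbounded, against
    [qpoch_inv_bound]. *)
Lemma qpoch_inf_neq0 b : `|b| < 1 -> qpoch_inf b b != 0.
Proof.
move=> b1; have [M M0 MP] := qpoch_inv_bound b1; apply/eqP => E.
have := @qpoch_cvg b b b1; rewrite E => /cvgrPdist_lt H.
have M1 : 0 < M + 1 by rewrite ltr_wpDl.
have [n _ /(_ n (leqnn n)) /=] := H (M + 1)^-1 (ltac:(by rewrite invr_gt0)).
rewrite sub0r normrN => lt.
have : `|qpoch b b n * (qpoch b b n)^-1| < 1.
  rewrite normrM; apply: le_lt_trans (ler_wpM2l (normr_ge0 _) (MP n)) _.
  apply: le_lt_trans (ler_wpM2r M0 (ltW lt)) _.
  by rewrite mulrC ltr_pdivrMr // mul1r ltrDl.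
by rewrite divff ?normr1 ?ltxx // qpochb_neq0 // => k; exact: subr1X_neq0.
Qed.

(* The ratio of consecutive terms is r^m T, eventually below rho. *)
Lemma superexp (r T rho : K) : 0 <= r < 1 -> 0 <= T -> 0 < rho <= 1 ->
  exists2 M : K, 0 <= M & forall m, r ^+ 'C(m, 2) * T ^+ m <= M * rho ^+ m.
Proof.
move=> r01 T0 /andP[p0 p1]; have /andP[r0 r1] := r01.
have [m0 m0P] := geo_cvg0 T0 r01 p0.
pose u m := r ^+ 'C(m, 2) * T ^+ m.
have u0 m : 0 <= u m by rewrite /u mulr_ge0 ?exprn_ge0.
have uS m : (m0 <= m)%N -> u m.+1 <= u m * rho.
  move=> le; rewrite /u bin2S exprD exprS.
  have -> : r ^+ 'C(m, 2) * r ^+ m * (T * T ^+ m) = u m * (T * r ^+ m) by rewrite /u; ring.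
  apply: ler_wpM2l => //; apply: le_trans (ltW m0P).
  rewrite ler_pdivlMr ?subr_gt0 //; apply: le_trans (_ : T * r ^+ m <= _).
    by rewrite ler_piMr ?mulr_ge0 ?exprn_ge0 // gerBl.
  by rewrite ler_wpM2l // ler_wiXn2l // ltW.
pose M := \sum_(k < m0.+1) u k / rho ^+ k.
have Mk k : 0 <= u k / rho ^+ k by rewrite divr_ge0 ?exprn_ge0 // ltW.
exists M; first by apply: sumr_ge0.
have small m : (m <= m0)%N -> u m <= M * rho ^+ m.
  move=> le; rewrite -ler_pdivrMr ?exprn_gt0 // /M.
  have lt : (m < m0.+1)%N by [].
  by rewrite (bigD1 (Ordinal lt)) //= lerDl sumr_ge0.
move=> m; have [/small //|/ltnW le] := leqP m m0.
elim: m le => [|m IH] le; first exact: (small 0%N).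
move: le; rewrite leq_eqVlt => /orP[/eqP E|lt]; first by apply: (small m.+1); rewrite E.
apply: le_trans (uS m lt) _; rewrite exprSr mulrA ler_wpM2r ?IH //; exact: ltW.
Qed.

Lemma cvg_subn (V : ptopologicalType) (u : nat -> V) (l : V) m :
  u @ \oo --> l -> (fun N => u (N - m)%N) @ \oo --> l.
Proof.
move=> ul; rewrite -(cvg_shiftn m) /=.
by rewrite (_ : (fun _ => _) = u) //; apply/funext => N; rewrite addnK.
Qed.

End InfiniteProducts.

Section Summation.
Variable R : realType.
Local Notation K := (Cx R).

Lemma has_sum_unique (f : nat -> K) s s' : has_sum f s -> has_sum f s' -> s = s'.
Proof. exact: Cx_cvg_unique. Qed.

Lemma eq_has_sum (f g : nat -> K) s : f =1 g -> has_sum f s -> has_sum g s.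
Proof.
move=> fg; rewrite /has_sum.
rewrite (_ : (fun N => \sum_(k < N) g k) = (fun N => \sum_(k < N) f k)) //.
by apply/funext => N; apply: eq_bigr => k _; rewrite fg.
Qed.

Lemma has_sumZ (c : K) (f : nat -> K) s : has_sum f s -> has_sum (fun k => c * f k) (c * s).
Proof.
move=> fs; rewrite /has_sum; under eq_fun do rewrite -mulr_sumr.
exact: (cvgM (cvg_cst c) fs).
Qed.

Lemma has_sum_drop k (f : nat -> K) s : (forall m, (m < k)%N -> f m = 0) ->
  has_sum (fun m => f (m + k)%N) s -> has_sum f s.
Proof.
move=> f0; rewrite /has_sum => fs; rewrite -(cvg_shiftn k) /=.
rewrite (_ : (fun _ => _) = (fun N => \sum_(m < N) f (m + k)%N)) //.
apply/funext => N; rewrite addnC big_split_ord /= big1 ?add0r => [|i _]; last exact: f0.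
by apply: eq_bigr => i _; rewrite addnC.
Qed.

Lemma half_gt0_le1 : 0 < (2^-1 : K) <= 1.
Proof. by rewrite invr_gt0 ltr0n invf_le1 ?ltr0n // ler1n. Qed.

Lemma half_ge0_lt1 : 0 <= (2^-1 : K) < 1.
Proof. by rewrite invr_ge0 ler0n invf_lt1 ?ltr0n // ltr1n. Qed.

End Summation.

Arguments has_sumZ {R} c {f s} _.

(** * Limits of the finite identities *)

Section QSeries.
Variables (R : realType) (b : Cx R).
Local Notation K := (Cx R).
Hypotheses (b0 : b != 0) (b1 : `|b| < 1).

Local Notation pb := (qpoch b b).
Let nb n : 1 - b ^+ n.+1 != 0 := subr1X_neq0 n b1.
Let r01 : 0 <= `|b| < 1. Proof. by rewrite normr_ge0 b1. Qed.

Lemma qfact_inv_cvg : (fun n => (pb n)^-1) @ \oo --> (qpoch_inf b b)^-1.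
Proof. exact: (cvgV (qpoch_inf_neq0 b1) (@qpoch_cvg _ _ _ b1)). Qed.

(** With X = c and B = c/a this is the usual limiting q-Gauss sum multiplied by (c;b)_oo. The factor
    b^C(m,2) beats every geometric growth, so the ratio 1/2 of the majorant is an arbitrary
    choice. *)
Lemma q_gauss X B :
  has_sum (fun m => b ^+ 'C(m, 2) * (\prod_(k < m) (X * b ^+ k - B))
     * qpoch_inf (X * b ^+ m) b / pb m) (qpoch_inf B b).
Proof.
have [M1 M10 M1P] := qpoch_bound b1 (normr_ge0 X).
have [M2 M20 M2P] := qpoch_inv_bound b1.
have TX : 0 <= `|X| + `|B| by rewrite addr_ge0.
have [|M3 M30 M3P] := @superexp R `|b| (`|X| + `|B|) 2^-1 r01 TX.
  exact: half_gt0_le1.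
have [|||||s gs Fs] := @tannery R (M3 * (M1 * (M2 * M2))) 2^-1 S
  (fun N m => b ^+ 'C(m, 2) * (\prod_(k < m) (X * b ^+ k - B))
     * qpoch (X * b ^+ m) b (N - m) / (pb m * pb (N - m)))
  (fun m => b ^+ 'C(m, 2) * (\prod_(k < m) (X * b ^+ k - B))
     * qpoch_inf (X * b ^+ m) b * ((pb m)^-1 * (qpoch_inf b b)^-1)).
- by rewrite !mulr_ge0.
- exact: half_ge0_lt1.
- by move=> N.
- move=> N m; rewrite invfM !normrM (mulrAC M3) normrX normr_prod.
  rewrite -!mulrA mulrA [leRHS]mulrA; apply: ler_pM => //.
  + by rewrite mulr_ge0 ?exprn_ge0 // prodr_ge0.
  + apply: le_trans _ (M3P m); apply: ler_wpM2l; first by rewrite exprn_ge0.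
    rewrite -[X in _ <= _ ^+ X]card_ord -prodr_const; apply: ler_prod => k _.
    rewrite normr_ge0 (le_trans (ler_normB _ _)) // lerD2r normrM normrX.
    by rewrite ler_piMr // exprn_ile1 // ltW.
  + apply: ler_pM => //.
      apply: M1P; rewrite normrM normrX ler_piMr // exprn_ile1 //; exact: ltW.
    by apply: ler_pM.
- move=> m; under eq_fun do rewrite invfM.
  apply: cvgM; last by apply: cvgM; [exact: cvg_cst|exact: (cvg_subn m qfact_inv_cvg)].
  by apply: cvgM; [exact: cvg_cst|exact: (cvg_subn m (@qpoch_cvg _ _ _ b1))].
have sE : s = qpoch_inf B b * (qpoch_inf b b)^-1.
  apply: Cx_cvg_unique Fs _; under eq_fun do rewrite (q_chu_vandermonde nb).
  exact: (cvgM (@qpoch_cvg _ _ _ b1) qfact_inv_cvg).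
have P0 := qpoch_inf_neq0 b1.
have := has_sumZ (qpoch_inf b b) gs; rewrite sE mulrCA (divff P0) mulr1.
apply: eq_has_sum => m.
by rewrite mulrC -!mulrA (mulVf P0) mulr1.
Qed.

Lemma euler_sum B : has_sum (fun m => b ^+ 'C(m, 2) * B ^+ m / pb m) (qpoch_inf (- B) b).
Proof.
have := @q_gauss 0 (- B); apply: eq_has_sum => m.
rewrite mul0r (qpoch_inf0 b1) mulr1.
under eq_bigr => k _ do rewrite mul0r sub0r opprK.
by rewrite prodr_const card_ord.
Qed.

Definition bailey_weight (y z : K) (n : nat) : K := z ^+ n * b ^+ 'C(n, 2) * qpoch (- y) b n.

(** The gamma_k of the conjugate Bailey pair whose delta_n is [bailey_weight]; e enters only through
    the relation y z = b^(1+e). *)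
Definition bailey_value (y z : K) (k : nat) : K :=
  z ^+ k * b ^+ 'C(k, 2) * qpoch (- y) b k * qpoch_inf (- z * b ^+ k) b / qpoch_inf b b.

Lemma bin2D m k : ('C(m + k, 2) = 'C(m, 2) + 'C(k, 2) + m * k)%N.
Proof. by have := triE (m + k)%N; have := triE m; have := triE k; rewrite !tri_nat; nia. Qed.

(** After n = m + k this is [q_gauss] at X = b^(1+2k+e) and B = -z b^k. The relation on y z is what
    makes X b^i - B factor as z b^k (1 + y b^(k+i)). *)
Lemma conjugate_bailey_pair (e k : nat) (y z : K) : y * z = b ^+ e.+1 ->
  has_sum (fun n => bailey_weight y z n * bailey_term b e n k) (bailey_value y z k).
Proof.
move=> yz; apply: (@has_sum_drop _ k) => [m lt|]; first by rewrite bailey_term_pos ?mulr0.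
have P0 := qpoch_inf_neq0 b1.
have := has_sumZ (z ^+ k * b ^+ 'C(k, 2) * qpoch (- y) b k / qpoch_inf b b)
  (@q_gauss (b * b ^+ (k + k + e)) (- z * b ^+ k)).
rewrite (_ : _ * qpoch_inf (- z * b ^+ k) b = bailey_value y z k); last first.
  by rewrite /bailey_value mulrAC.
apply: eq_has_sum => m; rewrite /bailey_weight /bailey_term.
have -> : (m + k)%N%:Z - k%:Z = m by lia.
have -> : (m + k)%N%:Z + k%:Z + e%:Z = (k + k + e + m)%N by lia.
rewrite /= bin2D (addnC m k) qpochD (exprD z) (exprD b (_ + _)%N (m * k)) (exprD b 'C(m, 2))
  (mulnC m k) (exprM b).
have -> : \prod_(i < m) (b * b ^+ (k + k + e) * b ^+ i - - z * b ^+ k) =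
    z ^+ m * (b ^+ k) ^+ m * qpoch (- y * b ^+ k) b m.
  have -> : z ^+ m * (b ^+ k) ^+ m = \prod_(i < m) (z * b ^+ k).
    by rewrite prodr_const card_ord exprMn.
  rewrite -big_split /=; apply: eq_bigr => i _.
  have -> : b * b ^+ (k + k + e) = y * z * b ^+ k * b ^+ k.
    by rewrite yz -exprS -!exprD; congr (_ ^+ _); lia.
  ring.
rewrite (@qpoch_infD _ b b (k + k + e + m)%N) //.
have := qpochb_neq0 nb (k + k + e + m); have := qpochb_neq0 nb m.
have : qpoch_inf (b * b ^+ (k + k + e + m)) b != 0.
  by apply: contra_neq P0 => E; rewrite (@qpoch_infD _ b b (k + k + e + m)%N) // E mulr0.
have -> : b * b ^+ (k + k + e) * b ^+ m = b * b ^+ (k + k + e + m) by rewrite (exprD b _ m) mulrA.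
move=> *; field.
by apply/and3P.
Qed.

(** Exchanges the sums over n and r: the inner sums truncated at n < N are bounded uniformly in r
    because the weight decays like |z|^n, while [c] supplies the decay in r. *)
Lemma bailey_sum (e : nat) (y z M rho : K) (c : int -> K) (g : nat -> K) :
  (e <= 1)%N -> y * z = b ^+ e.+1 -> `|z| < 1 -> 0 <= M -> 0 <= rho < 1 ->
  (forall k : nat, `|c k| <= M * rho ^+ k) ->
  (forall k : nat, `|c (Negz k)| <= M * rho ^+ k) ->
  (forall n N, (n < N)%N -> g n = bisum N (fun r => c r * bailey_term b e n r)) ->
  exists2 s, has_sum (fun n => bailey_weight y z n * g n) s &
    has_sum (fun k => c k * bailey_value y z k + c (Negz k) * bailey_value y z (k + 1 - e)%N) s.
Proof.
move=> le1 yz z1 M0 rho01 c1 c2 gE.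
have [M1 M10 M1P] := qpoch_bound b1 (normr_ge0 (- y)).
have [M2 M20 M2P] := qpoch_inv_bound b1.
have ipM t : `|qfact_inv b t| <= M2 by case: t => n //=; rewrite normr0.
have z01 : 0 <= `|z| < 1 by rewrite normr_ge0.
have wM n : `|bailey_weight y z n| <= M1 * `|z| ^+ n.
  rewrite /bailey_weight !normrM !normrX mulrC ler_pM ?M1P // ?mulr_ge0 ?exprn_ge0 //.
  by rewrite ler_piMr ?exprn_ge0 // exprn_ile1 // ltW.
pose D N r := \sum_(n < N) bailey_weight y z n * bailey_term b e n r.
pose M3 := M1 * (M2 * M2) * `|z| ^+ 0 / (1 - `|z|).
have M30 : 0 <= M3 by rewrite /M3 expr0 mulr1 divr_ge0 ?mulr_ge0 // subr_ge0 ltW.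
have DM N r : `|D N r| <= M3.
  rewrite /D -(big_mkord xpredT (fun n => bailey_weight y z n * bailey_term b e n r)).
  apply: geo_tail => // [|n]; first by rewrite !mulr_ge0.
  rewrite normrM mulrAC; apply: ler_pM => //.
  by rewrite /bailey_term normrM ler_pM.
(* The index k + 1 - e is the image of -(k+1) under r -> -r-e. *)
have Dneg n k : bailey_term b e n (Negz k) = bailey_term b e n (k + 1 - e)%N.
  by rewrite /bailey_term mulrC; congr (qfact_inv b _ * qfact_inv b _); rewrite NegzE; lia.
have [|||||s gs Fs] := @tannery R (M * M3 + M * M3) rho id
  (fun N k => c k * D N k + c (Negz k) * D N (Negz k))
  (fun k => c k * bailey_value y z k + c (Negz k) * bailey_value y z (k + 1 - e)%N).
- by apply: addr_ge0; apply: mulr_ge0.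
- by [].
- by [].
- move=> N k; apply: le_trans (ler_normD _ _) _; rewrite !normrM mulrDl (mulrAC M).
  by apply: lerD; apply: ler_pM.
- move=> k; apply: cvgD; (apply: cvgM; first exact: cvg_cst).
    exact: conjugate_bailey_pair.
  rewrite /D; under eq_fun do under eq_bigr do rewrite Dneg.
  exact: conjugate_bailey_pair.
exists s => //; rewrite /has_sum (_ : (fun N => _) = (fun N =>
  \sum_(k < N) (c k * D N k + c (Negz k) * D N (Negz k)))) //.
apply/funext => N.
rewrite (eq_bigr (fun n : 'I_N => \sum_(k < N) bailey_weight y z n *
    (c k * bailey_term b e n k + c (Negz k) * bailey_term b e n (Negz k)))) => [|n _]; last first.
  by rewrite (@gE n N) // mulr_sumr.
rewrite exchange_big; apply: eq_bigr => k _.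
rewrite /D !mulr_sumr -big_split; apply: eq_bigr => n _ /=; ring.
Qed.

End QSeries.

(** * The Jacobi triple product *)

Section JacobiTriple.
Variables (R : realType) (b : Cx R).
Local Notation K := (Cx R).
Hypotheses (b0 : b != 0) (b1 : `|b| < 1).

Local Notation pb := (qpoch b b).
Let nb n : 1 - b ^+ n.+1 != 0 := subr1X_neq0 n b1.
Let r01 : 0 <= `|b| < 1. Proof. by rewrite normr_ge0 b1. Qed.

(** Factor by factor, 1 - x b^-j = -x b^-j (1 - b^j/x) for j = 1, ..., n. *)
Lemma qpoch_rev (x : K) n : x != 0 ->
  qpoch (x / b ^+ n) b n * b ^+ 'C(n.+1, 2) = (- x) ^+ n * qpoch (b / x) b n.
Proof.
move=> x0; elim: n => [|n IH]; first by rewrite !qpoch0 expr0 mul1r.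
have -> : qpoch (x / b ^+ n.+1) b n.+1 = (1 - x / b ^+ n.+1) * qpoch (x / b ^+ n) b n.
  rewrite -add1n qpochD qpochS qpoch0 mul1r expr0 mulr1 expr1; congr (_ * qpoch _ _ _).
  by have := expf_neq0 n b0 => bn0; rewrite exprS; field; apply/andP.
rewrite bin2S exprD qpochS (exprS (- x)).
rewrite (_ : _ * _ * (_ * _) = (qpoch (x / b ^+ n) b n * b ^+ 'C(n.+1, 2)) *
   ((1 - x / b ^+ n.+1) * b ^+ n.+1)); last by ring.
rewrite IH (exprS b); have bn0 := expf_neq0 n b0; field.
by apply/and3P.
Qed.

(** Limit of Cauchy's finite form: [q_chu_vandermonde] of order 2n with X = 0 and B = x b^-n, where
    (x b^-n; b)_(2n) splits into (x;b)_n and a half to be reversed. The kernel tends to (b;b)_oo^-2,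
    which accounts for the final factor. *)
Lemma jacobi_triple (x : K) : x != 0 ->
  has_sum (fun k : nat => (-1) ^ k%:Z * b ^ tri k * x ^ k%:Z
      + (-1) ^ Negz k * b ^ tri (Negz k) * x ^ Negz k)
    (qpoch_inf x b * qpoch_inf (b / x) b * qpoch_inf b b).
Proof.
move=> x0.
pose t (r : int) := (-1) ^ r * b ^ tri r * x ^ r.
have triN (k : nat) : tri (Negz k) = ('C(k, 2) + (k + k + 1))%N.
  by have := triE (Negz k); have := triE k; rewrite tri_nat NegzE; nia.
have tN (k : nat) : `|t k| = `|b| ^+ 'C(k, 2) * `|x| ^+ k.
  by rewrite /t !normrM tri_nat -!exprnP !normrX normrN1 expr1n mul1r.
have tN' (k : nat) : `|t (Negz k)| <= `|x^-1| * (`|b| ^+ 'C(k, 2) * `|x^-1| ^+ k).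
  rewrite /t !normrM triN NegzE -!exprnN -exprnP !normrX !normfV !normrX normrN1 expr1n invr1 mul1r.
  rewrite -exprVn exprS exprD mulrCA; apply: ler_wpM2l; first by rewrite invr_ge0.
  apply: ler_wpM2r; first by rewrite exprn_ge0 // invr_ge0.
  by rewrite ler_piMr ?exprn_ge0 // exprn_ile1 // ltW.
have [|M1 M10 M1P] := @superexp R `|b| `|x| 2^-1 r01 (normr_ge0 x).
  exact: half_gt0_le1.
have [|M2 M20 M2P] := @superexp R `|b| `|x^-1| 2^-1 r01 (normr_ge0 _).
  exact: half_gt0_le1.
have [M3 M30 M3P] := qpoch_inv_bound b1.
have ipM z : `|qfact_inv b z| <= M3 by case: z => n //=; rewrite normr0.
have btM n r : `|bailey_term b 0 n r| <= M3 * M3 by rewrite /bailey_term normrM ler_pM.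
pose P := qpoch_inf b b; have P0 : P != 0 := qpoch_inf_neq0 b1.
have bt_cvg r : (fun n => bailey_term b 0 n r) @ \oo --> P^-1 * P^-1.
  have ipC (c : int) : (fun n : nat => qfact_inv b (n%:Z + c)) @ \oo --> P^-1.
    rewrite -(cvg_shiftn (absz c)).
    pose d : nat := absz ((absz c)%:Z + c).
    have H := qfact_inv_cvg b1; rewrite -(cvg_shiftn d) in H.
    rewrite (_ : (fun n => _) = (fun n => (pb (n + d)%N)^-1)) //.
    by apply/funext => n; have -> : (n + absz c)%N%:Z + c = (n + d)%N by lia.
  rewrite /bailey_term; apply: cvgM; first exact: ipC.
  by under eq_fun do rewrite addr0; exact: ipC.
have [|||||s gs Fs] := @tannery R (M1 * (M3 * M3) + `|x^-1| * M2 * (M3 * M3)) 2^-1 S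
  (fun n k => t k * bailey_term b 0 n k + t (Negz k) * bailey_term b 0 n (Negz k))
  (fun k => t k * (P^-1 * P^-1) + t (Negz k) * (P^-1 * P^-1)).
- by apply: addr_ge0; rewrite !mulr_ge0.
- exact: half_ge0_lt1.
- by move=> N.
- move=> N k; apply: le_trans (ler_normD _ _) _; rewrite mulrDl.
  rewrite (mulrAC M1) (mulrAC (`|x^-1| * M2)) (normrM (t k)) (normrM (t (Negz k))).
  apply: lerD; apply: ler_pM => //; first by rewrite tN.
  by apply: le_trans (tN' k) _; rewrite -mulrA ler_wpM2l.
- by move=> k; apply: cvgD; (apply: cvgM; [exact: cvg_cst|exact: bt_cvg]).
have fin n : \sum_(k < n.+1) (t k * bailey_term b 0 n k + t (Negz k) * bailey_term b 0 n (Negz k)) =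
    qpoch x b n * qpoch (b / x) b n / pb (n + n).
  rewrite -/(bisum n.+1 (fun r => t r * bailey_term b 0 n r)) (@bisum_shift _ _ n 0) //; last 2 first.
  - by move=> r lt; rewrite bailey_term_pos ?mulr0.
  - by move=> r lt; rewrite bailey_term_neg ?mulr0.
  rewrite !addn0.
  have := @q_chu_vandermonde _ _ nb (n + n) 0 (x / b ^+ n).
  rewrite qpochD divfK ?expf_neq0 // => E.
  have K0 : (- x) ^+ n / b ^+ 'C(n.+1, 2) != 0 by rewrite mulf_neq0 ?invr_eq0 ?expf_neq0 ?oppr_eq0.
  apply: (mulfI K0).
  have -> : (- x) ^+ n / b ^+ 'C(n.+1, 2) * (qpoch x b n * qpoch (b / x) b n / pb (n + n)) =
     qpoch (x / b ^+ n) b n * qpoch x b n / pb (n + n).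
    rewrite (_ : qpoch (x / b ^+ n) b n = (- x) ^+ n * qpoch (b / x) b n / b ^+ 'C(n.+1, 2)).
      by field; rewrite qpochb_neq0 ?expf_neq0.
    by rewrite -qpoch_rev // mulfK // expf_neq0.
  rewrite -E mulr_sumr; apply: eq_bigr => i _; move: (nat_of_ord i) (ltn_ord i) => {i} s' lt_s.
  have -> : \prod_(k < s') (0 * b ^+ k - x / b ^+ n) = (- (x / b ^+ n)) ^+ s'.
    by under eq_bigr => k _ do rewrite mul0r sub0r; rewrite prodr_const card_ord.
  have -> : qpoch (0 * b ^+ s') b (n + n - s') = 1.
    by rewrite mul0r /qpoch big1 // => k _; rewrite mul0r subr0.
  have -> : bailey_term b 0 n (s'%:Z - n%:Z) = (pb s' * pb (n + n - s'))^-1.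
    rewrite /bailey_term; have -> : n%:Z - (s'%:Z - n%:Z) = (n + n - s')%N by lia.
    have -> : n%:Z + (s'%:Z - n%:Z) + 0%:Z = s' by lia.
    by rewrite /= invfM mulrC.
  rewrite mulr1 /t mulrA; congr (_ / _).
  have E1 : (- x) ^+ n / b ^+ 'C(n.+1, 2) = (-1) ^ n%:Z * x ^ n%:Z * b ^ (- 'C(n.+1, 2)%:Z).
    by rewrite -(mulN1r x) exprMn -exprnN.
  have E2 : (- (x / b ^+ n)) ^+ s' = (-1) ^ s'%:Z * x ^ s'%:Z * b ^ (- n%:Z * s').
    by rewrite -(mulN1r (x / _)) !exprMn mulrA -exprz_exp -exprnN.
  have N10 : (-1 : K) != 0 by rewrite oppr_eq0 oner_eq0.
  rewrite E1 E2 [b ^+ 'C(s', 2)]exprnP !(expfzDr s'%:Z) //.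
  have -> : b ^ tri (s'%:Z - n%:Z) = b ^ 'C(s', 2)%:Z * b ^ (- n%:Z * s') * b ^ 'C(n.+1, 2)%:Z.
    rewrite -!expfzDr //; congr (_ ^ _).
    have := triE (s'%:Z - n%:Z); have := triE s'; have := triE n.+1; rewrite !tri_nat; nia.
  rewrite -!exprnN -!exprnP; field.
  by rewrite !expf_neq0.
have sE : s = qpoch_inf x b * qpoch_inf (b / x) b * P^-1.
  apply: Cx_cvg_unique Fs _; under eq_fun do rewrite fin.
  apply: cvgM; first by apply: cvgM; apply: qpoch_cvg.
  have := qfact_inv_cvg b1 => H; apply: (cvg_comp _ _ _ H) => A [N _ NA].
  by exists N => // n /= le; apply: NA; apply: (leq_trans le); rewrite leq_addr.
have := has_sumZ (P * P) gs; rewrite sE.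
have -> : P * P * (qpoch_inf x b * qpoch_inf (b / x) b / P) =
    qpoch_inf x b * qpoch_inf (b / x) b * P.
  by field.
by apply: eq_has_sum => k; rewrite -/(t k) -/(t (Negz k)); field.
Qed.

End JacobiTriple.

(** * Reduction of the triple sums *)

Section Reduction.
Variables (R : realType) (b : Cx R).
Local Notation K := (Cx R).
Hypotheses (b0 : b != 0) (b1 : `|b| < 1).

Local Notation pb := (qpoch b b).
Let nb n : 1 - b ^+ n.+1 != 0 := subr1X_neq0 n b1.

(** The diagonals n < 2N cover the square; the test clips the long ones to it. This is where a range
    N + N arises in [tannery]. *)
Lemma sum_antidiagonal (N : nat) (G : nat -> nat -> K) :
  \sum_(i < N) \sum_(j < N) G i j =
  \sum_(n < N + N) \sum_(i < N) (if (i <= n)%N && (n - i < N)%N then G i (n - i)%N else 0).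
Proof.
rewrite [RHS]exchange_big; apply: eq_bigr => -[i /= lt_i] _.
rewrite -(big_mkord xpredT (G i)).
rewrite -(big_mkord xpredT (fun n => if (i <= n)%N && (n - i < N)%N then G i (n - i)%N else 0)).
rewrite [RHS](@big_cat_nat _ _ _ i) //=; last by lia.
rewrite [X in _ = X + _]big_nat_cond [X in _ = X + _]big1 ?add0r; last first.
  by move=> n; rewrite andbT => /andP[_ lt]; rewrite leqNgt lt.
rewrite [RHS](@big_cat_nat _ _ _ (i + N)) //=; [|lia|lia].
rewrite [X in _ = _ + X]big_nat_cond [X in _ = _ + X]big1 ?addr0; last first.
  move=> n; rewrite andbT => /andP[le lt].
  by case: ifP => // /andP[le' lt']; lia.
have shift (H : nat -> K) : \sum_(i <= n < i + N) H n = \sum_(j < N) H (j + i)%N.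
  by rewrite -{1}(add0n i) big_addn (addnC i N) addnK big_mkord.
rewrite (shift (fun n => if (i <= n)%N && (n - i < N)%N then G i (n - i)%N else 0)) big_mkord.
apply: eq_bigr => j _.
by rewrite leq_addl addnK ltn_ord.
Qed.

(* The sum over k is Euler's, equal to (-y0 b^-n; b)_oo with n = i + j, which is
   the product of (-y0; b)_oo and, by reversal, of a multiple of (-b/y0; b)_n. *)
Lemma triple_sum (y0 z M rho s : K) (f : nat) (F : nat -> nat -> nat -> K) :
  y0 != 0 -> 0 <= M -> 0 <= rho < 1 ->
  (forall i j k : nat, F i j k =
     z ^+ (i + j) * b ^+ 'C(i + j, 2) * (b ^+ 'C((i + j).+1, 2) / y0 ^+ (i + j))
     * b ^ (i%:Z * i%:Z + f%:Z * i%:Z) * (b ^+ 'C(k, 2) * (y0 / b ^+ (i + j)) ^+ k)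
     / (pb i * pb j * pb k)) ->
  (forall i j k : nat, `|F i j k| <= M * rho ^+ (i + (i + j) + k)) ->
  has_sum (fun n => bailey_weight b (b / y0) z n * beta b f n) s ->
  tseries_to F (qpoch_inf (- y0) b * s).
Proof.
move=> y00 M0 rho01 FE FM hs; have /andP[rho0 rho1] := rho01.
have irho : 0 < 1 - rho by rewrite subr_gt0.
pose G N n i := if (i <= n)%N && (n - i < N)%N then \sum_(k < N) F i (n - i)%N k else 0.
(* The majorant exponent i + (i+j) + k separates into i, n and k, so the sums over k and over i each
   cost one factor 1/(1-rho) and rho^n remains. *)
have FM' i n k : (i <= n)%N -> `|F i (n - i)%N k| <= M * rho ^+ i * rho ^+ n * rho ^+ k.
  by move=> le; apply: le_trans (FM _ _ _) _; rewrite subnKC // -!mulrA -!exprD addnA.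
have Min i n : 0 <= M * rho ^+ i * rho ^+ n by rewrite !mulr_ge0 ?exprn_ge0.
have GM N n i : `|G N n i| <= (M * rho ^+ n / (1 - rho)) * rho ^+ i.
  rewrite /G; case: ifP => [/andP[le lt]|_]; last first.
    by rewrite normr0 !mulr_ge0 ?exprn_ge0 // invr_ge0 ltW.
  have := geo_tail 0 N (Min i n) rho01 (fun k => @FM' i n k le).
  rewrite big_mkord expr0 mulr1; congr (_ <= _); field; exact: lt0r_neq0.
pose h i n := z ^+ n * b ^+ 'C(n, 2) * (b ^+ 'C(n.+1, 2) / y0 ^+ n)
   * b ^ (i%:Z * i%:Z + f%:Z * i%:Z) / (pb i * pb (n - i)) * qpoch_inf (- (y0 / b ^+ n)) b.
have hF i n : (i <= n)%N -> has_sum (F i (n - i)%N) (h i n).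
  move=> le; have E := @euler_sum _ b b1 (y0 / b ^+ n).
  apply: eq_has_sum (has_sumZ (z ^+ n * b ^+ 'C(n, 2) * (b ^+ 'C(n.+1, 2) / y0 ^+ n)
   * b ^ (i%:Z * i%:Z + f%:Z * i%:Z) / (pb i * pb (n - i))) E) => k.
  by rewrite FE subnKC // !invfM; ring.
have [|||||t gt Ft] := @tannery R (M / (1 - rho) / (1 - rho)) rho (fun N => N + N)%N
  (fun N n => \sum_(i < N) G N n i) (fun n => \sum_(i < n.+1) h i n).
- by rewrite !mulr_ge0 ?invr_ge0 // ltW.
- exact: rho01.
- by move=> N; rewrite leq_addr.
- move=> N n; rewrite -(big_mkord xpredT (G N n)).
  have M'0 : 0 <= M * rho ^+ n / (1 - rho).
    by rewrite !mulr_ge0 ?exprn_ge0 ?invr_ge0 // ltW.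
  have := geo_tail 0 N M'0 rho01 (GM N n); rewrite expr0 mulr1; congr (_ <= _); ring.
(* Once N > n the square no longer clips diagonal n, and only the finitely many sums over k depend
   on N. *)
- move=> n; rewrite -(cvg_shiftn n.+1) /=.
  rewrite (_ : (fun _ => _) = (fun N => \sum_(i < n.+1)
     (if (i <= n)%N then \sum_(k < N + n.+1) F i (n - i)%N k else 0))).
    rewrite (eq_bigr (fun i : 'I_n.+1 => if (i <= n)%N then h i n else 0)); last first.
      by move=> i _; rewrite -ltnS ltn_ord.
    apply: (@cvg_sum_ord R n.+1 (fun N i =>
      if (i <= n)%N then \sum_(k < N + n.+1) F i (n - i)%N k else 0)
      (fun i => if (i <= n)%N then h i n else 0)) => i.
    case: ifP => le; last exact: cvg_cst.
    have := hF i n le; rewrite /has_sum => H.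
    by rewrite -(cvg_shiftn n.+1) in H.
  apply/funext => N; rewrite addnC big_split_ord /= [X in _ + X]big1 ?addr0; last first.
    by move=> i _; rewrite /G leqNgt ltnS leq_addr.
  apply: eq_bigr => i _; rewrite /G; have lt := ltn_ord i.
  have -> : (i <= n)%N by [].
  by have -> /= : (n - i < n.+1 + N)%N by lia.
have tE : t = qpoch_inf (- y0) b * s.
  apply: has_sum_unique gt _; have := has_sumZ (qpoch_inf (- y0) b) hs.
  apply: eq_has_sum => n; rewrite /beta !mulr_sumr; apply: eq_bigr => i _; rewrite /h.
  have bn0 := expf_neq0 n b0.
  rewrite (@qpoch_infD _ (- (y0 / b ^+ n)) b n) // -mulNr divfK //.
  have H : qpoch (- y0 / b ^+ n) b n =
     y0 ^+ n * qpoch (- (b / y0)) b n / b ^+ 'C(n.+1, 2).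
    have := @qpoch_rev _ b b0 (- y0) n; rewrite opprK oppr_eq0 y00 invrN mulrN => /(_ isT) <-.
    by rewrite mulfK // expf_neq0.
  rewrite H /bailey_weight invfM; set Q1 := qpoch _ _ _; set Q2 := qpoch_inf _ _; clearbody Q2.
  have := expf_neq0 n y00; have := expf_neq0 'C(n.+1, 2) b0.
  move: (b ^+ 'C(n.+1, 2)) (y0 ^+ n) => u v u0 v0; move: (pb _)^-1 (pb _)^-1 => w1 w2.
  by field; rewrite u0 v0.
rewrite -tE /tseries_to (_ : tsum F = (fun N => \sum_(n < N + N) \sum_(i < N) G N n i)) //.
by apply/funext => N; rewrite /tsum (sum_antidiagonal N (fun i j => \sum_(k < N) F i j k)).
Qed.

End Reduction.

(* [triple_sum] with b = q^B, y0 = q^eta, z = q^zeta; the exponent condition is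
   doubled to stay within the integers. *)
Lemma nahm_triple_sum (R : realType) (q : Cx R) (B eta zeta f e : nat)
  (Q : nat -> nat -> nat -> int) (c : int -> Cx R) (M S : Cx R) : q != 0 -> `|q| < 1 -> (0 < B)%N -> (0 < zeta)%N ->
  (e <= 1)%N -> (eta <= B)%N -> (B - eta + zeta = B * e.+1)%N ->
  (forall i j k : nat, Q i j k * 2 =
     2 * zeta%:Z * (i + j)%N%:Z + 2 * B%:Z * (i + j)%N%:Z * (i + j)%N%:Z
     - 2 * eta%:Z * (i + j)%N%:Z + 2 * B%:Z * (i%:Z * i%:Z + f%:Z * i%:Z)
     + B%:Z * (k%:Z * (k%:Z - 1)) + 2 * (eta%:Z - B%:Z * (i + j)%N%:Z) * k%:Z) ->
  (forall i j k : nat, (i + (i + j) + k)%N%:Z <= Q i j k + 2) ->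
  0 <= M ->
  (forall k : nat, `|c k| <= M * `|q| ^+ k) ->
  (forall k : nat, `|c (Negz k)| <= M * `|q| ^+ k) ->
  (forall n N, (n < N)%N -> beta (q ^+ B) f n = bisum N (fun r => c r * bailey_term (q ^+ B) e n r)) ->
  has_sum (fun k => c k * bailey_value (q ^+ B) (q ^+ (B - eta)) (q ^+ zeta) k
     + c (Negz k) * bailey_value (q ^+ B) (q ^+ (B - eta)) (q ^+ zeta) (k + 1 - e)%N) S ->
  tseries_to (fun i j k => q ^ Q i j k / (qpoch (q ^+ B) (q ^+ B) i * qpoch (q ^+ B) (q ^+ B) j
     * qpoch (q ^+ B) (q ^+ B) k)) (qpoch_inf (- q ^+ eta) (q ^+ B) * S).
Proof.
move=> q0 q1 B0 zeta0 le1 leB yz QE Qge M0 c1 c2 cE hS.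
have qX1 n : (0 < n)%N -> `|q ^+ n| < 1.
  by case: n => // n _; rewrite normrX exprn_ilt1.
have qb0 := expf_neq0 B q0; have qb1 := qX1 B B0; have q01 : 0 <= `|q| < 1 by rewrite normr_ge0.
have nq : 0 < `|q| by rewrite normr_gt0.
have yz' : q ^+ (B - eta) * q ^+ zeta = (q ^+ B) ^+ e.+1 by rewrite -exprD yz exprM.
have [s hs hs'] := bailey_sum qb0 qb1 le1 yz' (qX1 _ zeta0) M0 q01 c1 c2 cE.
rewrite -(has_sum_unique hs' hS).
have [M2 M20 M2P] := qpoch_inv_bound qb1.
apply: (@triple_sum _ _ qb0 qb1 (q ^+ eta) (q ^+ zeta) (`|q| ^- 2 * (M2 * M2 * M2)) `|q| s f).
- by rewrite expf_neq0.
- by rewrite !mulr_ge0 // invr_ge0 exprn_ge0.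
- exact: q01.
- move=> i j k; congr (_ / _); rewrite -!exprM expr_div_n -!exprM.
  rewrite !exprnN !exprnP.
  have -> : (q ^ B%:Z) ^ (i%:Z * i%:Z + f%:Z * i%:Z) = q ^ (B%:Z * (i%:Z * i%:Z + f%:Z * i%:Z)).
    by rewrite exprz_exp.
  rewrite -!expfzDr //; congr (q ^ _); have := QE i j k.
  have := triE (i + j)%N; have := triE (i + j).+1; have := triE k; rewrite !tri_nat; nia.
- move=> i j k; rewrite normrM [leRHS]mulrAC; apply: ler_pM => //.
    (* The lower bound m - 2 on [Q] may be negative, hence the factor |q|^-2 in the majorant. *)
    have := Qge i j k; set m := (i + (i + j) + k)%N => le.
    have -> : Q i j k = (absz (Q i j k + 2))%:Z - 2%:Z by lia.
    rewrite expfzDr // -exprnN -exprnP normrM mulrC normfV !normrX.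
    apply: ler_wpM2l; first by rewrite invr_ge0 exprn_ge0.
    by rewrite ler_wiXn2l ?ltW //; lia.
  by rewrite !invfM !normrM; apply: ler_pM => //; apply: ler_pM.
- have -> : q ^+ B / q ^+ eta = q ^+ (B - eta).
    by rewrite -[in LHS](subnK leB) exprD mulfK // expf_neq0.
  exact: hs.
Qed.

(** * Evaluation of the products *)

Section EtaQuotients.
Variable R : realType.
Local Notation K := (Cx R).

Lemma qpoch_dissect (a b : K) m n :
  qpoch a b (n * m) = \prod_(i < m) qpoch (a * b ^+ i) (b ^+ m) n.
Proof.
elim: n => [|n IH]; first by rewrite qpoch0 big1 // => i _; rewrite qpoch0.
rewrite mulSnr qpochD IH -big_split /=; apply: eq_bigr => i _.
by rewrite qpochS -!mulrA -exprD -exprM mulnC -exprD addnC.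
Qed.

Lemma cvg_prod_ord m (F : nat -> nat -> K) (g : nat -> K) :
  (forall k, (F^~ k) @ \oo --> g k) ->
  (fun N => \prod_(k < m) F N k) @ \oo --> \prod_(k < m) g k.
Proof.
move=> Fg; elim: m => [|m IH].
  rewrite big_ord0; under eq_fun do rewrite big_ord0; exact: cvg_cst.
rewrite big_ord_recr; under eq_fun do rewrite big_ord_recr.
exact: (cvgM IH (Fg m)).
Qed.

Lemma qpoch_inf_dissect (a b : K) m : `|b| < 1 -> (0 < m)%N ->
  qpoch_inf a b = \prod_(i < m) qpoch_inf (a * b ^+ i) (b ^+ m).
Proof.
move=> b1 m0; have bm1 : `|b ^+ m| < 1 by rewrite normrX exprn_ilt1 // -lt0n.
have H : (fun n => qpoch a b (n * m)) @ \oo --> qpoch_inf a b.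
  have H := @qpoch_cvg _ a b b1; apply: (cvg_comp _ _ _ H) => A [N _ NA].
  by exists N => // n /= le; apply: NA; apply: (leq_trans le); rewrite leq_pmulr.
apply: Cx_cvg_unique H _; under eq_fun do rewrite qpoch_dissect.
apply: (@cvg_prod_ord m (fun n i => qpoch (a * b ^+ i) (b ^+ m) n)
  (fun i => qpoch_inf (a * b ^+ i) (b ^+ m))) => i.
exact: qpoch_cvg.
Qed.

Lemma qpoch_inf_opp (a b : K) : `|b| < 1 ->
  qpoch_inf a b * qpoch_inf (- a) b = qpoch_inf (a ^+ 2) (b ^+ 2).
Proof.
move=> b1; have b21 : `|b ^+ 2| < 1 by rewrite normrX exprn_ilt1.
have H : (fun n => qpoch a b n * qpoch (- a) b n) @ \oo -->
    qpoch_inf a b * qpoch_inf (- a) b.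
  exact: (cvgM (@qpoch_cvg _ a b b1) (@qpoch_cvg _ (- a) b b1)).
apply: Cx_cvg_unique H _.
rewrite (_ : (fun _ => _) = qpoch (a ^+ 2) (b ^+ 2)); first exact: qpoch_cvg.
apply/funext => n; rewrite /= /qpoch -big_split; apply: eq_bigr => i _.
by rewrite /= exprAC; ring.
Qed.

Variable q : K.
Hypothesis q1 : `|q| < 1.

Lemma norm_qX n : (0 < n)%N -> `|q ^+ n| < 1.
Proof. by case: n => // n _; rewrite normrX exprn_ilt1. Qed.

Lemma J_neq0 m : (0 < m)%N -> J m q != 0.
Proof. by move=> m0; exact: (qpoch_inf_neq0 (norm_qX m0)). Qed.

Lemma JE m : J m q = qpoch_inf (q ^+ m) (q ^+ m).
Proof. by []. Qed.

Lemma JamE a m : Jam a m q =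
  qpoch_inf (q ^+ a) (q ^+ m) * qpoch_inf (q ^+ (m - a)) (q ^+ m) * qpoch_inf (q ^+ m) (q ^+ m).
Proof. by []. Qed.

Lemma J_double m : (0 < m)%N ->
  J m q = qpoch_inf (q ^+ m) (q ^+ (2 * m)) * J (2 * m) q.
Proof.
move=> m0; rewrite /J (@qpoch_inf_dissect _ _ 2 (norm_qX m0)) //.
by rewrite !big_ord_recr big_ord0 /= mul1r expr0 mulr1 -exprM mulnC expr1 -expr2 -exprM mulnC.
Qed.

Lemma qpoch_inf_neg_q : qpoch_inf (- q) q = J 2 q / J 1 q.
Proof.
have J1 := J_neq0 (isT : (0 < 1)%N).
apply: (canRL (mulfK J1)); rewrite mulrC.
have -> : J 1 q = qpoch_inf q q by rewrite /J expr1.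
exact: qpoch_inf_opp.
Qed.

Lemma qpoch_inf_neg_q2 :
  qpoch_inf (- q) (q ^+ 2) = J 2 q ^+ 2 / (J 1 q * J 4 q).
Proof.
have J1 := J_neq0 (isT : (0 < 1)%N); have J2 := J_neq0 (isT : (0 < 2)%N).
have J4 := J_neq0 (isT : (0 < 4)%N).
have E1 : J 1 q = qpoch_inf q (q ^+ 2) * J 2 q := J_double (isT : (0 < 1)%N).
have E2 : J 2 q = qpoch_inf (q ^+ 2) (q ^+ 4) * J 4 q := J_double (isT : (0 < 2)%N).
have E3 : qpoch_inf q (q ^+ 2) * qpoch_inf (- q) (q ^+ 2) = qpoch_inf (q ^+ 2) (q ^+ 4).
  by rewrite (qpoch_inf_opp q (norm_qX (isT : (0 < 2)%N))) -exprM.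
move: E1 E2 E3 J1 J2 J4.
move: (qpoch_inf q _) (qpoch_inf (- q) _) (qpoch_inf (q ^+ 2) _) (J 1 q) (J 2 q) (J 4 q).
move=> u v w j1 j2 j4 -> -> <- _; rewrite !mulf_eq0 !negb_or => /andP[/andP[u0 v0] _] j40.
by field; rewrite ?u0 ?v0 ?j40.
Qed.

Lemma qpoch_inf_q3_q6 : qpoch_inf (q ^+ 3) (q ^+ 6) = J 3 q / J 6 q.
Proof.
have J6 := J_neq0 (isT : (0 < 6)%N).
by rewrite (J_double (isT : (0 < 3)%N)) mulfK.
Qed.

(** Dissecting J_1/J_2 = (q;q^2)_oo modulo 6 gives the bases q, q^3, q^5; the middle one is
    J_3/J_6. *)
Lemma qpoch_inf_q5_q6 :
  qpoch_inf (q ^+ 5) (q ^+ 6) * qpoch_inf q (q ^+ 6) = J 1 q * J 6 q / (J 2 q * J 3 q).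
Proof.
have J2 := J_neq0 (isT : (0 < 2)%N); have J3 := J_neq0 (isT : (0 < 3)%N).
have J6 := J_neq0 (isT : (0 < 6)%N).
rewrite (J_double (isT : (0 < 1)%N)).
rewrite (@qpoch_inf_dissect _ _ 3 (norm_qX (isT : (0 < 2)%N))) //.
rewrite !big_ord_recr big_ord0 /= mul1r expr0 mulr1 -!exprM -!exprD.
rewrite -[(1 + 2 * 1)%N]/3%N -[(1 + 2 * 2)%N]/5%N -[(2 * 3)%N]/6%N qpoch_inf_q3_q6 expr1.
move: (qpoch_inf q _) (qpoch_inf _ _) (J 2 q) (J 3 q) (J 6 q) J2 J3 J6 => a c j2 j3 j6 J2 J3 J6.
by field; rewrite J2 J3.
Qed.

End EtaQuotients.

(* Otherwise a failed match makes unification unfold the limits. *)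
Opaque J Jam qpoch_inf.

Section BaileyValues.
Variables (R : realType) (b : Cx R).
Hypothesis b1 : `|b| < 1.

(** For z = y the finite and the infinite product join into (-y;b)_oo, leaving a pure theta term in
    k. *)
Lemma bailey_value_diag (y : Cx R) k : bailey_value b y y k =
  y ^+ k * b ^+ 'C(k, 2) * (qpoch_inf (- y) b / qpoch_inf b b).
Proof. by rewrite (@qpoch_infD _ (- y) b k b1) /bailey_value !mulrA. Qed.

(** For z = y b the two products miss exactly the factor 1 + y b^k of (-y;b)_oo. *)
Lemma bailey_value_shift (y : Cx R) k : 1 + y * b ^+ k != 0 ->
  bailey_value b y (y * b) k =
  (y * b) ^+ k * b ^+ 'C(k, 2) * (qpoch_inf (- y) b / qpoch_inf b b) / (1 + y * b ^+ k).
Proof.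
move=> y0; rewrite (@qpoch_infD _ (- y) b k.+1 b1) /bailey_value qpochS exprS -(mulNr y b) !mulrA.
have -> : 1 - - y * b ^+ k = 1 + y * b ^+ k by ring.
by move: (qpoch_inf _ _) (qpoch_inf _ _)^-1 => u v; field.
Qed.

End BaileyValues.

Lemma bailey_coef_bound (R : realType) (q : Cx R) (B e d : nat) (r : int) (k : nat) :
  `|q| < 1 -> (0 < B)%N ->
  k%:Z <= tri (r + d%:Z) + 2 * (r * r + e%:Z * r) -> `|bailey_coef (q ^+ B) e d r| <= `|q| ^+ k.
Proof.
move=> q1 B0 le; rewrite /bailey_coef.
move: (tri _ + _) le => E le; have -> : E = (absz E)%:Z by lia.
rewrite normrM -exprnP !normrX -exprM.
have -> : `|(-1 : Cx R) ^ r| = 1.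
  by case: r => n; rewrite ?NegzE -?exprnN -?exprnP ?normfV normrX normrN1 expr1n ?invr1.
have leE : (k <= absz E)%N by lia.
rewrite mul1r; apply: ler_wiXn2l => //; first exact: ltW.
by apply: leq_trans leE _; rewrite leq_pmull.
Qed.

Lemma tri_Negz (k : nat) : tri (Negz k) = 'C(k, 2)%:Z + 2 * k%:Z + 1.
Proof. by have := triE (Negz k); have := triE k; rewrite tri_nat NegzE; nia. Qed.

Lemma triS (z : int) : tri (z + 1) = tri z + z.
Proof. by have := triE z; have := triE (z + 1); nia. Qed.

Lemma binC2 (k : nat) : k%:Z * k%:Z = 2 * 'C(k, 2)%:Z + k%:Z.
Proof. by have := triE k; rewrite tri_nat; lia. Qed.

(** * The five identities *)

(** Integrality gives d(d-1) >= 0 and, in the next lemma, (d-1)(d-2) >= 0. Applied to the squares in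
    the exponent, they yield the linear lower bound required by [nahm_triple_sum]. *)
Lemma sqr_int_ge (d : int) : d <= d * d.
Proof. nia. Qed.

Lemma sqr_int_ge3 (d : int) : 3 * d <= d * d + 2.
Proof. by have := sqr_int_ge (d - 1); lia. Qed.

Section Cases.
Variables (R : realType) (q : Cx R).
Local Notation K := (Cx R).
Hypotheses (q0 : q != 0) (q1 : `|q| < 1).

Let nq n (lt : (0 < n)%N) m : 1 - (q ^+ n) ^+ m.+1 != 0 := subr1X_neq0 m (norm_qX q1 lt).

(** Reduces the matching of theta terms to an equation between integer exponents. *)
Lemma qpow_eq (A B D E : nat) (a b d : int) : A%:Z * a + B%:Z * b = D%:Z * d + E%:Z ->
  (q ^+ A) ^ a * (q ^+ B) ^ b = (q ^+ D) ^ d * q ^+ E.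
Proof.
by move=> H; rewrite (exprnP _ E) !exprnP !exprz_exp -expfzDr // H expfzDr.
Qed.

Lemma monomial_eq (s C : K) (A B D E F G : nat) (a b d : int) :
  A%:Z * a + B%:Z * b = D%:Z * d + (E + F * G)%N%:Z ->
  C * (s * (q ^+ A) ^ a * (q ^+ B) ^ b) = s * (q ^+ D) ^ d * (q ^+ E * (q ^+ F) ^+ G * C).
Proof.
by move=> H; rewrite -exprM -exprD -(mulrA s) (qpow_eq H); ring.
Qed.

Lemma jacobi_Jam (a c m : nat) : (0 < m)%N -> (a + c)%N = m ->
  has_sum (fun k : nat => (-1) ^ k%:Z * (q ^+ m) ^ tri k * (q ^+ c) ^ k%:Z
      + (-1) ^ Negz k * (q ^+ m) ^ tri (Negz k) * (q ^+ c) ^ Negz k) (Jam a m q).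
Proof.
move=> m0 acm.
have := jacobi_triple (expf_neq0 m q0) (norm_qX q1 m0) (expf_neq0 c q0).
have E1 : q ^+ m / q ^+ c = q ^+ a by rewrite -acm exprD mulfK // expf_neq0.
have E2 : (m - a)%N = c by rewrite -acm addKn.
by rewrite E1 JamE E2 (mulrC (qpoch_inf (q ^+ c) _)).
Qed.

Lemma one_addX_neq0 (x : K) : `|x| < 1 -> 1 + x != 0.
Proof.
by move=> x1; rewrite addrC -(opprK 1) subr_eq0; apply: contraTneq x1 => ->; rewrite normrN1 ltxx.
Qed.

Lemma signz_Negz (k : nat) : (-1 : K) ^ Negz k = - (-1) ^ k%:Z.
Proof. by rewrite NegzE -exprnN -exprnP exprS mulN1r invrN -exprVn invrN1. Qed.

(** Parameters b = q^2, y = z = q, e = f = 0. The form d = 1 of the unit pair gives theta exponents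
    6r^2 + r = 12 tri(r) + 7r, hence x = q^7 in Jacobi's product. *)
Lemma nahm_identity1 : tseries_to (fun i j k : nat =>
     q ^ (4 * i%:Z ^+ 2 + 2 * j%:Z ^+ 2 + k%:Z ^+ 2 + 4 * i%:Z * j%:Z
          - 2 * i%:Z * k%:Z - 2 * j%:Z * k%:Z)
     / (qpoch (q ^+ 2) (q ^+ 2) i * qpoch (q ^+ 2) (q ^+ 2) j * qpoch (q ^+ 2) (q ^+ 2) k))
     (J 2 q ^+ 3 * Jam 5 12 q / (J 1 q ^+ 2 * J 4 q ^+ 2)).
Proof.
have q2 := norm_qX q1 (isT : (0 < 2)%N).
have n2 := nq (isT : (0 < 2)%N).
pose C := qpoch_inf (- q) (q ^+ 2) / qpoch_inf (q ^+ 2) (q ^+ 2).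
pose S := C * Jam 5 12 q.
have HS : has_sum (fun k : nat =>
    bailey_coef (q ^+ 2) 0 1 k * bailey_value (q ^+ 2) (q ^+ (2 - 1)) (q ^+ 1) k
    + bailey_coef (q ^+ 2) 0 1 (Negz k) * bailey_value (q ^+ 2) (q ^+ (2 - 1)) (q ^+ 1) (k + 1 - 0)%N) S.
  have := has_sumZ C (@jacobi_Jam 5 7 12 isT erefl).
  apply: eq_has_sum => k; rewrite !(bailey_value_diag q2) -/C mulrDr /bailey_coef !triS addn1 subn0.
  congr (_ + _); apply: monomial_eq; rewrite ?tri_nat ?tri_Negz ?bin2S ?NegzE.
    by have := binC2 k; nia.
  by have := binC2 k; nia.
have V : qpoch_inf (- q ^+ 1) (q ^+ 2) * S = J 2 q ^+ 3 * Jam 5 12 q / (J 1 q ^+ 2 * J 4 q ^+ 2).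
  rewrite /S /C expr1 (qpoch_inf_neg_q2 q1) -(JE q 2).
  have := J_neq0 q1 (isT : (0 < 1)%N); have := J_neq0 q1 (isT : (0 < 2)%N).
  have := J_neq0 q1 (isT : (0 < 4)%N).
  move: (J 1 q) (J 2 q) (J 4 q) (Jam 5 12 q) => j1 j2 j4 X J4 J2 J1.
  by field; rewrite J1 J2 J4.
rewrite -V.
apply: (nahm_triple_sum (e := 0) (f := 0) (zeta := 1)
  (c := bailey_coef (q ^+ 2) 0 1) (M := 1) q0 q1) HS => //.
- by move=> i j k; rewrite !PoszD; ring.
- move=> i j k; have := sqr_int_ge (k%:Z - (i + j)%N%:Z); have := sqr_int_ge ((i + j)%N%:Z - 1).
  have := sqr_int_ge i; lia.
- by move=> k; rewrite mul1r; apply: bailey_coef_bound => //; rewrite triS tri_nat; nia.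
- by move=> k; rewrite mul1r; apply: bailey_coef_bound => //; rewrite triS tri_Negz NegzE; nia.
- by move=> n N lt; exact: (beta_bailey_pair n2 (expf_neq0 2 q0)).
Qed.

(** Weight as in the first identity, but f = 1 while e = 0, which calls for
    [beta_bailey_pair_shift]. The theta exponents are 6r^2 + 3r = 12 tri(r) + 9r. *)
Lemma nahm_identity3 : tseries_to (fun i j k : nat =>
     q ^ (4 * i%:Z ^+ 2 + 2 * j%:Z ^+ 2 + k%:Z ^+ 2 + 4 * i%:Z * j%:Z
          - 2 * i%:Z * k%:Z - 2 * j%:Z * k%:Z + 2 * i%:Z)
     / (qpoch (q ^+ 2) (q ^+ 2) i * qpoch (q ^+ 2) (q ^+ 2) j * qpoch (q ^+ 2) (q ^+ 2) k))
     (J 2 q ^+ 3 * Jam 3 12 q / (J 1 q ^+ 2 * J 4 q ^+ 2)).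
Proof.
have q2 := norm_qX q1 (isT : (0 < 2)%N).
have n2 := nq (isT : (0 < 2)%N).
pose C := qpoch_inf (- q) (q ^+ 2) / qpoch_inf (q ^+ 2) (q ^+ 2).
pose S := C * Jam 3 12 q.
have HS : has_sum (fun k : nat =>
    bailey_coef (q ^+ 2) 1 0 k * bailey_value (q ^+ 2) (q ^+ (2 - 1)) (q ^+ 1) k
    + bailey_coef (q ^+ 2) 1 0 (Negz k) * bailey_value (q ^+ 2) (q ^+ (2 - 1)) (q ^+ 1) (k + 1 - 0)%N) S.
  have := has_sumZ C (@jacobi_Jam 3 9 12 isT erefl).
  apply: eq_has_sum => k; rewrite !(bailey_value_diag q2) -/C mulrDr /bailey_coef !addr0 addn1 subn0.
  congr (_ + _); apply: monomial_eq; rewrite ?tri_nat ?tri_Negz ?bin2S ?NegzE.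
    by have := binC2 k; nia.
  by have := binC2 k; nia.
have V : qpoch_inf (- q ^+ 1) (q ^+ 2) * S = J 2 q ^+ 3 * Jam 3 12 q / (J 1 q ^+ 2 * J 4 q ^+ 2).
  rewrite /S /C expr1 (qpoch_inf_neg_q2 q1) -(JE q 2).
  have := J_neq0 q1 (isT : (0 < 1)%N); have := J_neq0 q1 (isT : (0 < 2)%N).
  have := J_neq0 q1 (isT : (0 < 4)%N).
  move: (J 1 q) (J 2 q) (J 4 q) (Jam 3 12 q) => j1 j2 j4 X J4 J2 J1.
  by field; rewrite J1 J2 J4.
rewrite -V.
apply: (nahm_triple_sum (e := 0) (f := 1) (zeta := 1)
  (c := bailey_coef (q ^+ 2) 1 0) (M := 1) q0 q1) HS => //.
- by move=> i j k; rewrite !PoszD; ring.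
- move=> i j k; have := sqr_int_ge (k%:Z - (i + j)%N%:Z); have := sqr_int_ge ((i + j)%N%:Z - 1).
  have := sqr_int_ge i; lia.
- by move=> k; rewrite mul1r; apply: bailey_coef_bound => //; rewrite addr0 tri_nat; nia.
- by move=> k; rewrite mul1r; apply: bailey_coef_bound => //; rewrite addr0 tri_Negz NegzE; nia.
- by move=> n N lt; exact: (beta_bailey_pair_shift n2 (expf_neq0 2 q0)).
Qed.

(** Here y = q, z = q^3, e = f = 1. The terms r = k and r = -1-k share one [bailey_value], with
    denominator 1 + x for x = q^(2k+1), and have coefficients u and -u x^2. Since (1 - x^2)/(1 + x)
    = 1 - x, together they equal the two Jacobi terms together, though not one by one. *)
Lemma nahm_identity5 : tseries_to (fun i j k : nat =>
     q ^ (4 * i%:Z ^+ 2 + 2 * j%:Z ^+ 2 + k%:Z ^+ 2 + 4 * i%:Z * j%:Z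
          - 2 * i%:Z * k%:Z - 2 * j%:Z * k%:Z + 4 * i%:Z + 2 * j%:Z)
     / (qpoch (q ^+ 2) (q ^+ 2) i * qpoch (q ^+ 2) (q ^+ 2) j * qpoch (q ^+ 2) (q ^+ 2) k))
     (J 2 q ^+ 3 * Jam 1 12 q / (J 1 q ^+ 2 * J 4 q ^+ 2)).
Proof.
have q2 := norm_qX q1 (isT : (0 < 2)%N).
have n2 := nq (isT : (0 < 2)%N).
pose C := qpoch_inf (- q) (q ^+ 2) / qpoch_inf (q ^+ 2) (q ^+ 2).
pose S := C * Jam 1 12 q.
have HS : has_sum (fun k : nat =>
    bailey_coef (q ^+ 2) 1 0 k * bailey_value (q ^+ 2) (q ^+ (2 - 1)) (q ^+ 3) k
    + bailey_coef (q ^+ 2) 1 0 (Negz k) * bailey_value (q ^+ 2) (q ^+ (2 - 1)) (q ^+ 3) (k + 1 - 1)%N) S.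
  have := has_sumZ C (@jacobi_Jam 1 11 12 isT erefl).
  apply: eq_has_sum => k; rewrite addnK.
  have x0 : 1 + q * (q ^+ 2) ^+ k != 0.
    by apply: one_addX_neq0; rewrite -exprM -exprS; apply: norm_qX.
  have -> : q ^+ 3 = q * q ^+ 2 by rewrite -exprS.
  rewrite expr1 (bailey_value_shift q2 x0) -/C.
  have -> : (q * q ^+ 2) ^+ k * (q ^+ 2) ^+ 'C(k, 2) = q ^+ (3 * k + 2 * 'C(k, 2)).
    by rewrite -exprS -!exprM -exprD.
  have xE : q * (q ^+ 2) ^+ k = q ^+ (2 * k).+1 by rewrite -exprM -exprS.
  have -> : (-1 : K) ^ k%:Z * (q ^+ 12) ^ tri k * (q ^+ 11) ^ k%:Z =
      bailey_coef (q ^+ 2) 1 0 k * q ^+ (3 * k + 2 * 'C(k, 2)).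
    rewrite /bailey_coef addr0 -!(mulrA (_ ^ _)); congr (_ * _); apply: qpow_eq.
    by rewrite tri_nat; have := binC2 k; nia.
  have -> : (-1 : K) ^ Negz k * (q ^+ 12) ^ tri (Negz k) * (q ^+ 11) ^ Negz k =
      - (bailey_coef (q ^+ 2) 1 0 k * q ^+ (3 * k + 2 * 'C(k, 2)) * (q * (q ^+ 2) ^+ k)).
    rewrite xE signz_Negz !mulNr /bailey_coef addr0 -!(mulrA (_ ^ _)) -exprD; congr (- (_ * _)).
    by apply: qpow_eq; rewrite tri_nat tri_Negz NegzE; have := binC2 k; nia.
  have -> : bailey_coef (q ^+ 2) 1 0 (Negz k) = - (bailey_coef (q ^+ 2) 1 0 k * (q * (q ^+ 2) ^+ k) ^+ 2).
    rewrite xE -exprM /bailey_coef signz_Negz !addr0 mulNr -(mulrA (_ ^ _)); congr (- (_ * _)).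
    rewrite -[LHS]mulr1 -(expr0z (q ^+ 0)); apply: qpow_eq.
    by rewrite tri_nat tri_Negz NegzE; have := binC2 k; nia.
  move: {xE} (q * (q ^+ 2) ^+ k) x0 (bailey_coef _ _ _ k) (q ^+ (3 * k + 2 * _)) => x x0 u v.
  by field.
have V : qpoch_inf (- q ^+ 1) (q ^+ 2) * S = J 2 q ^+ 3 * Jam 1 12 q / (J 1 q ^+ 2 * J 4 q ^+ 2).
  rewrite /S /C expr1 (qpoch_inf_neg_q2 q1) -(JE q 2).
  have := J_neq0 q1 (isT : (0 < 1)%N); have := J_neq0 q1 (isT : (0 < 2)%N).
  have := J_neq0 q1 (isT : (0 < 4)%N).
  move: (J 1 q) (J 2 q) (J 4 q) (Jam 1 12 q) => j1 j2 j4 X J4 J2 J1.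
  by field; rewrite J1 J2 J4.
rewrite -V.
apply: (nahm_triple_sum (e := 1) (f := 1) (zeta := 3)
  (c := bailey_coef (q ^+ 2) 1 0) (M := 1) q0 q1) HS => //.
- by move=> i j k; rewrite !PoszD; ring.
- move=> i j k; have := sqr_int_ge (k%:Z - (i + j)%N%:Z); have := sqr_int_ge ((i + j)%N%:Z - 1).
  have := sqr_int_ge i; lia.
- by move=> k; rewrite mul1r; apply: bailey_coef_bound => //; rewrite addr0 tri_nat; nia.
- by move=> k; rewrite mul1r; apply: bailey_coef_bound => //; rewrite addr0 tri_Negz NegzE; nia.
- by move=> n N lt; exact: (beta_bailey_pair n2 (expf_neq0 2 q0)).
Qed.

(** The half-integer terms k^2/2 - k/2 and, below, k^2/2 + k/2 are binomial coefficients, so the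
    integer division is exact, also at k = 0 where [k.-1] is 0. *)
Lemma half_bin2 k : ((k * k.-1) %/ 2 = 'C(k, 2))%N.
Proof. by rewrite bin2 divn2. Qed.

Lemma half_bin2S k : ((k * k.+1) %/ 2 = 'C(k.+1, 2))%N.
Proof. by rewrite mulnC (half_bin2 k.+1). Qed.

Lemma qpoch_inf_neg1 : qpoch_inf (- 1) q = 2 * qpoch_inf (- q) q.
Proof.
by rewrite (@qpoch_infD _ _ _ 1 q1) qpochS qpoch0 expr0 expr1 mulr1 mul1r opprK mulN1r.
Qed.

(** Parameters b = y = z = q, e = f = 1, theta exponents 3r^2 + 2r = 6 tri(r) + 5r. The Euler
    prefactor is (-1;q)_oo, whose first factor is the 2 on the right. *)
Lemma nahm_identity4 : tseries_to (fun i j k : nat =>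
     q ^ (2 * i%:Z ^+ 2 + j%:Z ^+ 2 + ((k * k.-1) %/ 2)%N%:Z + 2 * i%:Z * j%:Z
          - i%:Z * k%:Z - j%:Z * k%:Z + 2 * i%:Z + j%:Z)
     / (qpoch q q i * qpoch q q j * qpoch q q k))
     (2 * (J 2 q * J 6 q ^+ 2 / (J 1 q ^+ 2 * J 3 q))).
Proof.
have q11 := norm_qX q1 (isT : (0 < 1)%N).
have n1 := nq (isT : (0 < 1)%N).
pose C := qpoch_inf (- q) (q ^+ 1) / qpoch_inf (q ^+ 1) (q ^+ 1).
pose S := C * Jam 1 6 q.
have HS : has_sum (fun k : nat =>
    bailey_coef (q ^+ 1) 1 0 k * bailey_value (q ^+ 1) (q ^+ (1 - 0)) (q ^+ 1) k
    + bailey_coef (q ^+ 1) 1 0 (Negz k) * bailey_value (q ^+ 1) (q ^+ (1 - 0)) (q ^+ 1) (k + 1 - 1)%N) S.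
  have := has_sumZ C (@jacobi_Jam 1 5 6 isT erefl).
  apply: eq_has_sum => k; rewrite !(bailey_value_diag q11) -/C mulrDr /bailey_coef !addr0 addnK.
  congr (_ + _); apply: monomial_eq; rewrite ?tri_nat ?tri_Negz ?bin2S ?NegzE.
    by have := binC2 k; nia.
  by have := binC2 k; nia.
have V : qpoch_inf (- q ^+ 0) (q ^+ 1) * S = 2 * (J 2 q * J 6 q ^+ 2 / (J 1 q ^+ 2 * J 3 q)).
  have EJ : Jam 1 6 q = J 1 q * J 6 q / (J 2 q * J 3 q) * J 6 q.
    rewrite JamE expr1 -(JE q 6) [X in X * _]mulrC; congr (_ * _).
    exact: (qpoch_inf_q5_q6 q1).
  rewrite /S /C EJ expr0 -(JE q 1) expr1 qpoch_inf_neg1 (qpoch_inf_neg_q q1).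
  have := J_neq0 q1 (isT : (0 < 1)%N); have := J_neq0 q1 (isT : (0 < 2)%N).
  have := J_neq0 q1 (isT : (0 < 3)%N).
  move: (J 1 q) (J 2 q) (J 3 q) (J 6 q) => j1 j2 j3 j6 J3 J2 J1.
  by field; rewrite J1 J2 J3.
rewrite -V.
apply: (nahm_triple_sum (e := 1) (f := 1) (zeta := 1)
  (c := bailey_coef (q ^+ 1) 1 0) (M := 1) q0 q1) HS => //.
- by move=> i j k; rewrite half_bin2 !PoszD; have := binC2 k; nia.
- move=> i j k; rewrite half_bin2; have := sqr_int_ge3 (k%:Z - (i + j)%N%:Z).
  have := sqr_int_ge3 (i + j)%N; have := sqr_int_ge i; have := binC2 k; lia.
- by move=> k; rewrite mul1r; apply: bailey_coef_bound => //; rewrite addr0 tri_nat; nia.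
- by move=> k; rewrite mul1r; apply: bailey_coef_bound => //; rewrite addr0 tri_Negz NegzE; nia.
- by move=> n N lt; exact: (beta_bailey_pair n1 (expf_neq0 1 q0)).
Qed.

(* Averaging the coefficients with d = 0 and d = 1 cancels the denominator 1 + q^r
   coming from (-1; q)_r / (-q; q)_r. *)
Lemma nahm_identity2 : tseries_to (fun i j k : nat =>
     q ^ (2 * i%:Z ^+ 2 + j%:Z ^+ 2 + ((k * k.+1) %/ 2)%N%:Z + 2 * i%:Z * j%:Z
          - i%:Z * k%:Z - j%:Z * k%:Z)
     / (qpoch q q i * qpoch q q j * qpoch q q k))
     (J 2 q ^+ 2 * J 3 q ^+ 2 / (J 1 q ^+ 3 * J 6 q)).
Proof.
have q11 := norm_qX q1 (isT : (0 < 1)%N).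
have n1 := nq (isT : (0 < 1)%N).
pose C := qpoch_inf (- 1) (q ^+ 1) / qpoch_inf (q ^+ 1) (q ^+ 1).
pose S := C / 2 * Jam 3 6 q.
pose c r := (bailey_coef (q ^+ 1) 0 0 r + bailey_coef (q ^+ 1) 0 1 r) / 2.
have x0 m : 1 + q ^+ m != 0.
  by case: m => [|m]; [rewrite expr0 (pnatr_eq0 _ 2)|apply: one_addX_neq0; apply: norm_qX].
have bv m : bailey_value (q ^+ 1) (q ^+ (1 - 1)) (q ^+ 1) m =
    q ^+ (m + 'C(m, 2)) * C / (1 + q ^+ m).
  have := @bailey_value_shift _ (q ^+ 1) q11 1 m; rewrite !mul1r -exprM mul1n => /(_ (x0 m)).
  by rewrite -!exprM !mul1n -exprD.
have HS : has_sum (fun k : nat => c k * bailey_value (q ^+ 1) (q ^+ (1 - 1)) (q ^+ 1) k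
    + c (Negz k) * bailey_value (q ^+ 1) (q ^+ (1 - 1)) (q ^+ 1) (k + 1 - 0)%N) S.
  have := has_sumZ (C / 2) (@jacobi_Jam 3 3 6 isT erefl).
  apply: eq_has_sum => k; rewrite !bv subn0 addn1 /c.
  (* For r = k the d = 1 coefficient is q^k times the d = 0 one; for r = -(k+1) the roles are
     exchanged, with ratio q^(k+1). Either way the average contains 1 + q^|r|, the denominator of
     the value at |r|. *)
  have -> : bailey_coef (q ^+ 1) 0 1 k = bailey_coef (q ^+ 1) 0 0 k * q ^+ k.
    rewrite /bailey_coef -(mulrA (_ ^ _)); congr (_ * _).
    rewrite -[LHS]mulr1 -(expr0z (q ^+ 0)); apply: qpow_eq.
    by rewrite triS !addr0; nia.
  have -> : bailey_coef (q ^+ 1) 0 0 (Negz k) = bailey_coef (q ^+ 1) 0 1 (Negz k) * q ^+ k.+1.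
    rewrite /bailey_coef -(mulrA (_ ^ _)); congr (_ * _).
    rewrite -[LHS]mulr1 -(expr0z (q ^+ 0)); apply: qpow_eq.
    by rewrite triS !addr0 NegzE; nia.
  have -> : (-1 : K) ^ k%:Z * (q ^+ 6) ^ tri k * (q ^+ 3) ^ k%:Z =
      bailey_coef (q ^+ 1) 0 0 k * q ^+ (k + 'C(k, 2)).
    rewrite /bailey_coef addr0 -!(mulrA (_ ^ _)); congr (_ * _); apply: qpow_eq.
    by rewrite tri_nat; have := binC2 k; nia.
  have -> : (-1 : K) ^ Negz k * (q ^+ 6) ^ tri (Negz k) * (q ^+ 3) ^ Negz k =
      bailey_coef (q ^+ 1) 0 1 (Negz k) * q ^+ (k.+1 + 'C(k.+1, 2)).
    rewrite /bailey_coef triS -!(mulrA (_ ^ _)); congr (_ * _); apply: qpow_eq.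
    by rewrite tri_Negz NegzE bin2S; have := binC2 k; nia.
  have := x0 k; have := x0 k.+1.
  move: (bailey_coef _ _ _ k) (bailey_coef _ _ _ (Negz k)).
  move: (q ^+ (k + _)) (q ^+ (k.+1 + _)) (q ^+ k) (q ^+ k.+1).
  by move=> w w' x x' u v X' X; field; rewrite X X'.
have V : qpoch_inf (- q ^+ 1) (q ^+ 1) * S = J 2 q ^+ 2 * J 3 q ^+ 2 / (J 1 q ^+ 3 * J 6 q).
  have EJ : Jam 3 6 q = (J 3 q / J 6 q) * (J 3 q / J 6 q) * J 6 q.
    by rewrite JamE -(JE q 6) -[(6 - 3)%N]/3%N (qpoch_inf_q3_q6 q1).
  rewrite /S /C EJ -(JE q 1) expr1 qpoch_inf_neg1 (qpoch_inf_neg_q q1).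
  have := J_neq0 q1 (isT : (0 < 1)%N); have := J_neq0 q1 (isT : (0 < 6)%N).
  move: (J 1 q) (J 2 q) (J 3 q) (J 6 q) => j1 j2 j3 j6 J6 J1.
  by field; rewrite J1 J6.
have c_bound r k : `|bailey_coef (q ^+ 1) 0 0 r| <= `|q| ^+ k -> `|bailey_coef (q ^+ 1) 0 1 r| <= `|q| ^+ k ->
    `|c r| <= 1 * `|q| ^+ k.
  move=> B0 B1; rewrite mul1r /c normrM normfV normr_nat ler_pdivrMr ?ltr0n // mulr_natr mulr2n.
  by apply: le_trans (ler_normD _ _) _; apply: lerD.
rewrite -V.
apply: (nahm_triple_sum (e := 0) (f := 0) (zeta := 1)
  (c := c) (M := 1) q0 q1) HS => //.
- by move=> i j k; rewrite half_bin2S bin2S !PoszD; have := binC2 k; nia.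
- move=> i j k; rewrite half_bin2S bin2S; have := sqr_int_ge (k%:Z - (i + j)%N%:Z).
  have := sqr_int_ge3 (i + j)%N; have := sqr_int_ge i; have := binC2 k; lia.
- by move=> k; apply: c_bound; apply: bailey_coef_bound => //; rewrite ?triS ?addr0 tri_nat; nia.
- by move=> k; apply: c_bound; apply: bailey_coef_bound => //; rewrite ?triS ?addr0 tri_Negz NegzE; nia.
move=> n N lt.
have H0 : beta (q ^+ 1) 0 n = bisum N (fun r => bailey_coef (q ^+ 1) 0 0 r * bailey_term (q ^+ 1) 0 n r).
  exact: (beta_bailey_pair n1 (expf_neq0 1 q0)).
have H1 : beta (q ^+ 1) 0 n = bisum N (fun r => bailey_coef (q ^+ 1) 0 1 r * bailey_term (q ^+ 1) 0 n r).
  exact: (beta_bailey_pair n1 (expf_neq0 1 q0)).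
have -> : beta (q ^+ 1) 0 n = (beta (q ^+ 1) 0 n + beta (q ^+ 1) 0 n) / 2 by field.
rewrite {1}H0 H1 /bisum -big_split mulr_suml; apply: eq_bigr => r _; rewrite /c /=; ring.
Qed.

End Cases.

(** * The case q = 0 *)

Section ZeroCase.
Variable R : realType.
Local Notation K := (Cx R).

Lemma tseries_to_finite (F : nat -> nat -> nat -> K) :
  (forall i j k, ~~ [&& i == 0, j == 0 & (k < 2)]%N -> F i j k = 0) ->
  tseries_to F (F 0%N 0%N 0%N + F 0%N 0%N 1%N).
Proof.
move=> F0; rewrite /tseries_to -(cvg_shiftn 2).
rewrite (_ : (fun _ => _) = (fun=> F 0%N 0%N 0%N + F 0%N 0%N 1%N)); first exact: cvg_cst.
apply/funext => N; rewrite /tsum addn2 big_ord_recl [X in _ + X]big1 ?addr0; last first.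
  by move=> i _; rewrite big1 // => j _; rewrite big1 // => k _; rewrite F0.
rewrite big_ord_recl [X in _ + X]big1 ?addr0; last first.
  by move=> j _; rewrite big1 // => k _; rewrite F0.
rewrite 2!big_ord_recl [X in _ + (_ + X)]big1 ?addr0 // => k _.
by rewrite F0.
Qed.

Lemma qpoch_zero n : qpoch (0 : K) 0 n = 1.
Proof. by rewrite /qpoch big1 // => i _; rewrite mul0r subr0. Qed.

Lemma J_zero m : (0 < m)%N -> J m (0 : K) = 1.
Proof. by move=> m0; rewrite JE expr0n gtn_eqF // qpoch_inf0 // normr0. Qed.

Lemma Jam_zero a m : (0 < a < m)%N -> Jam a m (0 : K) = 1.
Proof.
move=> /andP[a0 am]; rewrite JamE !expr0n !gtn_eqF ?subn_gt0 // ?(ltn_trans a0) //.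
by rewrite qpoch_inf0 ?normr0 // !mulr1.
Qed.

(** An integer power of 0 is 1 at exponent 0 and 0 otherwise, so the sum counts the zeros of the
    exponent, which lie among i = j = 0, k < 2. *)
Lemma tseries_to_zero (Q : nat -> nat -> nat -> int) (b s : K) : b = 0 ->
  (forall i j k, Q i j k = 0 -> [&& i == 0, j == 0 & (k < 2)]%N) ->
  s = (Q 0%N 0%N 0%N == 0)%:R + (Q 0%N 0%N 1%N == 0)%:R ->
  tseries_to (fun i j k => 0 ^ Q i j k / (qpoch b b i * qpoch b b j * qpoch b b k)) s.
Proof.
move=> -> Q0 ->.
have FE i j k : 0 ^ Q i j k / (qpoch 0 0 i * qpoch 0 0 j * qpoch 0 0 k)
    = (Q i j k == 0)%:R :> K by rewrite !qpoch_zero !mulr1 invr1 mulr1 exp0rz.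
have := @tseries_to_finite (fun i j k => 0 ^ Q i j k / (qpoch 0 0 i * qpoch 0 0 j * qpoch 0 0 k)).
rewrite !FE; apply=> i j k nz; rewrite FE.
by case: eqP => // E; rewrite Q0 in nz.
Qed.

End ZeroCase.

Lemma sum_sqr_eq0 (x y : int) (i j k : nat) : (i + j)%N%:Z * (i + j)%N%:Z + x + y = 0 ->
  0 <= x -> 0 <= y -> (x = 0 -> i = 0%N -> j = 0%N -> (k < 2)%N) ->
  [&& i == 0, j == 0 & (k < 2)]%N.
Proof.
move=> E x0 y0 H; have ij : (i + j = 0)%N by nia.
have i0 : i = 0%N by lia.
have j0 : j = 0%N by lia.
by rewrite i0 j0 /= H //; rewrite i0 j0 in E; lia.
Qed.

Theorem theorem4p13 (R : realType) (q : Cx R) (hq : `|q| < 1) :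
  [/\
   tseries_to (fun i j k : nat =>
     q ^ (4 * i%:Z ^+ 2 + 2 * j%:Z ^+ 2 + k%:Z ^+ 2 + 4 * i%:Z * j%:Z
          - 2 * i%:Z * k%:Z - 2 * j%:Z * k%:Z)
     / (qpoch (q ^+ 2) (q ^+ 2) i * qpoch (q ^+ 2) (q ^+ 2) j * qpoch (q ^+ 2) (q ^+ 2) k))
     (J 2 q ^+ 3 * Jam 5 12 q / (J 1 q ^+ 2 * J 4 q ^+ 2)),
   tseries_to (fun i j k : nat =>
     q ^ (2 * i%:Z ^+ 2 + j%:Z ^+ 2 + ((k * k.+1) %/ 2)%N%:Z + 2 * i%:Z * j%:Z
          - i%:Z * k%:Z - j%:Z * k%:Z)
     / (qpoch q q i * qpoch q q j * qpoch q q k))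
     (J 2 q ^+ 2 * J 3 q ^+ 2 / (J 1 q ^+ 3 * J 6 q)),
   tseries_to (fun i j k : nat =>
     q ^ (4 * i%:Z ^+ 2 + 2 * j%:Z ^+ 2 + k%:Z ^+ 2 + 4 * i%:Z * j%:Z
          - 2 * i%:Z * k%:Z - 2 * j%:Z * k%:Z + 2 * i%:Z)
     / (qpoch (q ^+ 2) (q ^+ 2) i * qpoch (q ^+ 2) (q ^+ 2) j * qpoch (q ^+ 2) (q ^+ 2) k))
     (J 2 q ^+ 3 * Jam 3 12 q / (J 1 q ^+ 2 * J 4 q ^+ 2)),
   tseries_to (fun i j k : nat =>
     q ^ (2 * i%:Z ^+ 2 + j%:Z ^+ 2 + ((k * k.-1) %/ 2)%N%:Z + 2 * i%:Z * j%:Z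
          - i%:Z * k%:Z - j%:Z * k%:Z + 2 * i%:Z + j%:Z)
     / (qpoch q q i * qpoch q q j * qpoch q q k))
     (2 * (J 2 q * J 6 q ^+ 2 / (J 1 q ^+ 2 * J 3 q)))
 & tseries_to (fun i j k : nat =>
     q ^ (4 * i%:Z ^+ 2 + 2 * j%:Z ^+ 2 + k%:Z ^+ 2 + 4 * i%:Z * j%:Z
          - 2 * i%:Z * k%:Z - 2 * j%:Z * k%:Z + 4 * i%:Z + 2 * j%:Z)
     / (qpoch (q ^+ 2) (q ^+ 2) i * qpoch (q ^+ 2) (q ^+ 2) j * qpoch (q ^+ 2) (q ^+ 2) k))
     (J 2 q ^+ 3 * Jam 1 12 q / (J 1 q ^+ 2 * J 4 q ^+ 2))].
Proof.
have [q0|q0] := eqVneq q 0; last first.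
  split; [exact: nahm_identity1|exact: nahm_identity2|exact: nahm_identity3|exact: nahm_identity4|exact: nahm_identity5].
subst q; have z2 : (0 : Cx R) ^+ 2 = 0 by rewrite expr0n.
pose sq (x : int) := x * x; have sq0 (x : int) : 0 <= sq x by rewrite /sq; nia.
split; apply: tseries_to_zero => //.
- move=> i j k E.
  apply: (@sum_sqr_eq0 (sq (k%:Z - (i + j)%N%:Z)) (2 * i%:Z * i%:Z)) => //; rewrite /sq; nia.
- rewrite !J_zero // Jam_zero // !expr1n !mulr1 invr1 mulr1; exact: (esym (addr0 1)).
- move=> i j k; rewrite half_bin2S bin2S; have := binC2 k => K2 E.
  apply: (@sum_sqr_eq0 (sq (k%:Z - (i + j)%N%:Z)) (2 * i%:Z * i%:Z + k%:Z)) => //; rewrite /sq; nia.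
- rewrite !J_zero // !expr1n !mulr1 invr1 mulr1; exact: (esym (addr0 1)).
- move=> i j k E.
  apply: (@sum_sqr_eq0 (sq (k%:Z - (i + j)%N%:Z)) (2 * i%:Z * i%:Z + 2 * i%:Z)) => //; rewrite /sq; nia.
- rewrite !J_zero // Jam_zero // !expr1n !mulr1 invr1 mulr1; exact: (esym (addr0 1)).
- move=> i j k; rewrite half_bin2; have := binC2 k.
  have := sqr_int_ge (k%:Z - (i + j)%N%:Z) => K1 K2 E.
  (* Twice the exponent is n^2 + (d^2 - d) + 2i^2 + 3i + j with n = i + j and d = k - n. As d^2 - d
     vanishes at d = 1 too, both k = 0 and k = 1 survive and the sum is 2. *)
  apply: (@sum_sqr_eq0 (sq (k%:Z - (i + j)%N%:Z) - (k%:Z - (i + j)%N%:Z))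
    (2 * i%:Z * i%:Z + 3 * i%:Z + j%:Z)) => //; rewrite /sq; nia.
- rewrite !J_zero // !expr1n !mulr1 invr1 !mulr1; exact: (@natrD (Cx R) 1 1).
- move=> i j k E.
  apply: (@sum_sqr_eq0 (sq (k%:Z - (i + j)%N%:Z)) (2 * i%:Z * i%:Z + 4 * i%:Z + 2 * j%:Z)) => //; rewrite /sq; nia.
- rewrite !J_zero // Jam_zero // !expr1n !mulr1 invr1 mulr1; exact: (esym (addr0 1)).
Qed.
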